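(* Let $K>0$, let $(X_t)_{t\in\mathbb{R}}$ be a real-valued Lévy process, and let $(Q_t)_{t}$ be the associated stationary workload process in $[0,K]$, obtained by reflecting the Lévy process from below at $0$ and from above at $K$. Assume $\mathrm{Var}(Q_0)>0$. Then the correlation function $$r(t):=\frac{\mathrm{Cov}(Q_0,Q_t)}{\sqrt{\mathrm{Var}(Q_0)\,\mathrm{Var}(Q_t)}},\qquad t\geqslant 0,$$ is non-negative, non-increasing and convex on $[0,\infty)$.
   Context: A Lévy process is a càdlàg process with stationary independent increments and $X_0=0$. Given an initial level $Q_0\in[0,K]$, the doubly reflected process is $Q_t=Q_0+X_t+R_t^--R_t^+\in[0,K]$, $t\geqslant 0$, where $(R^-_t)_{t\geqslant 0}$ and $(R^+_t)_{t\geqslant0}$ are the non-decreasing càdlàg processes (the regulators, accounting for $R_0^\pm=0$) satisfying $\int_0^\infty Q_t\,\mathrm{d}R_t^-=\int_0^\infty (K-Q_t)\,\mathrm{d}R_t^+=0$. Equivalently, $Q=\Gamma^+[\Gamma^-[Q_0+X]]$ with $$\Gamma^-[Y]_t:=Y_t+\max\Big\{0,-\inf_{0\leqslant u\leqslant t}Y_u\Big\},$$ $$\Gamma^+[Y]_t:=Y_t-\sup_{0\leqslant s\leqslant t}\min\Big\{\max\{Y_s-K,0\},\inf_{s\leqslant u\leqslant t}Y_u\Big\}.$$ Stationarity means that $Q_0$ is independent of $(X_t)_{t\geqslant 0}$ and is distributed according to a stationary law, so that $(Q_t)_{t\geqslant 0}$ is a stationary process. *)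

(* Defs.v *)
From HB Require Import structures.
From mathcomp Require Import all_boot all_order all_algebra.
From mathcomp Require Import all_classical all_reals all_analysis.

Set Implicit Arguments.
Unset Strict Implicit.
Unset Printing Implicit Defensive.

Import Order.TTheory GRing.Theory Num.Theory.
Import numFieldNormedType.Exports.

Local Open Scope classical_set_scope.
Local Open Scope ring_scope.

Definition cadlag (R : realType) (f : R -> R) : Prop :=
  right_continuous f /\ forall t : R, cvg (f @ t^'-).

(* The product rule for subfamilies is the case B i = setT for the other i. *)
Definition mutually_independent d (T : measurableType d) (R : realType)
    (P : probability T R) (n : nat) (Z : 'I_n -> T -> R) : Prop :=
  forall B : 'I_n -> set R, (forall i, measurable (B i)) ->
    P [set w | forall i, B i (Z i w)] = (\prod_(i < n) P (Z i @^-1` B i))%E.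

(* The quantification is over measurable sets only: a probability is a total
   function on sets, unconstrained outside the sigma-algebra. *)
Definition same_law d (T : measurableType d) (R : realType)
    (P : probability T R) (Y Z : T -> R) : Prop :=
  forall B : set R, measurable B -> P (Y @^-1` B) = P (Z @^-1` B).

Definition process_sigma_algebra d (T : measurableType d) (R : realType)
    (D : set R) (X : R -> T -> R) : set (set T) :=
  <<s \bigcup_(t in D) preimage_set_system setT (X t) measurable >>.

Definition independent_of_process d (T : measurableType d) (R : realType)
    (P : probability T R) (Y : T -> R) (D : set R) (X : R -> T -> R) : Prop :=
  forall (B : set R) (A : set T), measurable B ->
    process_sigma_algebra D X A ->
    P (Y @^-1` B `&` A) = (P (Y @^-1` B) * P A)%E.

Record levy_process d (T : measurableType d) (R : realType)
    (P : probability T R) (X : R -> {RV P >-> R}) : Prop := LevyProcess {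
  levy_cadlag : forall w, cadlag (fun t => X t w) ;
  levy_at0 : forall w, X 0 w = 0 ;
  (* Any finite t_0 <= ... <= t_n extends to a nondecreasing sequence. *)
  levy_independent_increments : forall (n : nat) (t : nat -> R),
    {homo t : i j / (i <= j)%N >-> i <= j} ->
    mutually_independent P (fun (i : 'I_n) w => X (t i.+1) w - X (t i) w) ;
  levy_stationary_increments : forall s t h : R, s <= t ->
    same_law P (fun w => X (t + h) w - X (s + h) w) (fun w => X t w - X s w)
}.

(* Gamma^- and Gamma^+, the reflection maps at 0 and at K; only the restriction
   of Y to [0, t] matters. The infima and suprema are those of bounded nonempty
   sets when Y is cadlag. *)
Definition reflect_below (R : realType) (Y : R -> R) (t : R) : R :=
  Y t + Num.max 0 (- inf [set Y u | u in `[0, t]]).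

Definition reflect_above (R : realType) (K : R) (Y : R -> R) (t : R) : R :=
  Y t - sup [set Num.min (Num.max (Y s - K) 0) (inf [set Y u | u in `[s, t]])
            | s in `[0, t]].

(* The values of Q at negative times are unconstrained. *)
Record stationary_workload d (T : measurableType d) (R : realType)
    (P : probability T R) (K : R) (X Q : R -> {RV P >-> R}) : Prop :=
  StationaryWorkload {
  workload_initial : forall w, 0 <= Q 0 w <= K ;
  workload_reflection : forall (t : R) w, 0 <= t ->
    Q t w = reflect_above K (reflect_below (fun s => Q 0 w + X s w)) t ;
  workload_independent :
    independent_of_process P (Q 0) [set t : R | 0 <= t] (fun t => X t : T -> R) ;
  workload_stationary_law : forall t : R, 0 <= t -> same_law P (Q t) (Q 0)
}.

Definition correlation_function d (T : measurableType d) (R : realType)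
    (P : probability T R) (Q : R -> {RV P >-> R}) (t : R) : R :=
  fine (covariance P (Q 0) (Q t)) /
    Num.sqrt (fine ('V_P[Q 0%R])%E * fine ('V_P[Q t])%E).

(* Main.v *)
(* Write Q_0 - m for the centred initial level and c(t) = E[(Q_0 - m) Q_t]. On a
   time grid, two-sided reflection is the recursion v' = clamp (v + increment),
   and these schemes converge to Q pathwise as the mesh tends to 0. By the Markov
   property of the recursion, c(t) - c(t+b) is a limit of E[(Q_0 - m) phi(Q_0)],
   where phi is nondecreasing because clamped steps are monotone and contract
   distances; Chebyshev's association inequality gives c(t+b) <= c(t). Shifting
   time by h only replaces phi(Q_0) by phi(Q_h), and
   E[Q_0 phi(Q_h)] <= E[Q_0 phi(Q_0)] because Q_h and Q_0 have the same law: with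
   Phi a primitive of phi, (Q_0 - Q_h) phi(Q_h) <= Phi(Q_0) - Phi(Q_h). So the
   decrements of c are nonincreasing in time, which is convexity. *)

Require Import Defs.
From HB Require Import structures.
From mathcomp Require Import all_boot all_order all_algebra.
From mathcomp Require Import all_classical all_reals all_analysis.
From mathcomp Require Import measurable_realfun ring lra.

Set Implicit Arguments.
Unset Strict Implicit.
Unset Printing Implicit Defensive.

Import Order.TTheory GRing.Theory Num.Theory.
Import numFieldNormedType.Exports.

Local Open Scope classical_set_scope.
Local Open Scope ring_scope.

(** * The Skorokhod recursion *)

(** The Markov property is used on the grid only: the reflection formula for Q involves running
    infima and suprema of a cadlag path, whereas a grid step needs just the current value and an
    independent increment. The price is a passage to the limit. It works because [0, T[ splits into
    finitely many blocks on which the path oscillates little, and a fine grid meets each of them;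
    all values lie in [0, K], so dominated convergence carries the limit to expectations. Two
    obstacles shape the convexity argument. The function phi depends on the grid, and the scheme at
    time h need not have the stationary law; since every phi is 1-Lipschitz on [0, K], exchanging
    the scheme at h for Q_h costs at most K E|scheme - Q_h|, and stationarity is used only
    afterwards. Decrements are compared for steps of equal length, and monotonicity of c, rather
    than continuity, then gives convexity. Non-negativity is the association inequality again: c(t)
    is a limit of E[(Q_0 - m) g(Q_0)] with g nondecreasing. *)

Definition clamp (R : realType) (K x : R) : R := Num.min (Num.max x 0) K.

Section clamp.
Variables (R : realType) (K : R).
Hypothesis K0 : 0 <= K.

Lemma clamp_itv (x : R) : 0 <= clamp K x <= K.
Proof. by rewrite ge_min lexx orbT andbT le_min le_max lexx orbT. Qed.

Lemma clamp_id (x : R) : 0 <= x <= K -> clamp K x = x.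
Proof. by move=> /andP[x0 xK]; rewrite /clamp max_l // min_l. Qed.

Lemma clamp_le (x y : R) : x <= y -> clamp K x <= clamp K y.
Proof.
move=> xy; rewrite /clamp.
by case: (leP x 0) => ?; case: (leP y 0) => ?; rewrite /Order.min; do ?case: ifPn;
  rewrite -?leNgt => *; lra.
Qed.

Lemma clamp_contract (x y : R) : x <= y -> clamp K y - clamp K x <= y - x.
Proof.
move=> xy; rewrite /clamp.
by case: (leP x 0) => ?; case: (leP y 0) => ?; rewrite /Order.min; do ?case: ifPn;
  rewrite -?leNgt => *; lra.
Qed.

(** This is one update of [upper_regulator]: p is the lower reflected value and S the amount already
    removed at K. The minimum is the effect of the barrier 0, the outer maximum that of K. *)
Lemma clamp_sub (p S : R) : 0 <= S -> 0 <= p ->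
  clamp K (p - S) = p - Num.max (Num.min S p) (Num.max (p - K) 0).
Proof.
move=> S0 p0; have Kge0 := K0; have [Sp|pS] := leP S p; last first.
  rewrite [Num.max p _]max_l /clamp; last by rewrite ge_max p0 andbT gerBl.
  by rewrite max_r ?min_l //; lra.
rewrite /clamp max_l ?subr_ge0 //; have [pK|Kp] := leP (p - K) 0.
  by rewrite max_l // min_l //; lra.
by have [?|?] := leP S (p - K); [rewrite min_r // | rewrite min_l //]; lra.
Qed.

Lemma measurable_clamp : measurable_fun setT (clamp K).
Proof. by apply: nondecreasing_measurable => // x y; exact: clamp_le. Qed.

End clamp.

Section skorokhod_recursion.
Variables (R : realType) (K : R) (y : nat -> R).
Hypothesis K0 : 0 <= K.

Fixpoint lower_regulator (i : nat) : R :=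
  if i is j.+1 then Num.max (lower_regulator j) (- y i) else Num.max 0 (- y 0%N).

Definition lower_reflected (i : nat) : R := y i + lower_regulator i.

(** Recursive form of the supremum in [reflect_above]: index i caps every earlier term by the value
    Z_i and adds its own term, which is max (Z_i - K) 0 because Z_i and K are nonnegative. *)
Fixpoint upper_regulator (i : nat) : R :=
  if i is j.+1 then
    Num.max (Num.min (upper_regulator j) (lower_reflected i))
            (Num.max (lower_reflected i - K) 0)
  else Num.max (lower_reflected 0%N - K) 0.

(** Testing against arbitrary bounds a replaces reasoning about the running maximum; [regulator_le]
    is the same test in continuous time, so the two regulators can be compared bound by bound. *)
Lemma lower_regulator_le (i : nat) (a : R) :
  lower_regulator i <= a <-> 0 <= a /\ forall j, (j <= i)%N -> - y j <= a.
Proof.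
elim: i => [|i IH] /=.
  rewrite ge_max; split=> [/andP[a0 ya]|[-> /(_ 0%N) ->//]].
  by split=> // j; rewrite leqn0 => /eqP ->.
rewrite ge_max; split=> [/andP[/IH[a0 ya] yia]|[a0 ya]].
  by split=> // j; rewrite leq_eqVlt => /predU1P[->//|]; exact: ya.
apply/andP; split; last exact: ya.
by apply/IH; split=> // j ji; apply: ya; exact: leqW.
Qed.

Lemma lower_reflected_ge0 (i : nat) : 0 <= lower_reflected i.
Proof.
have /lower_regulator_le[_ /(_ i (leqnn _))] := lexx (lower_regulator i).
by rewrite /lower_reflected; lra.
Qed.

Lemma upper_regulator_ge0 (i : nat) : 0 <= upper_regulator i.
Proof. by case: i => [|i] /=; rewrite !le_max ?lexx !orbT. Qed.

(** For a > 0 the truncation at 0 cannot reach the level a, so a single index j must witness it.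
    Comparing suprema then amounts to exhibiting witnesses. *)
Lemma upper_regulator_ge (i : nat) (a : R) : 0 < a ->
  a <= upper_regulator i <->
  exists2 j, (j <= i)%N & a <= lower_reflected j - K /\
    forall k, (j <= k <= i)%N -> a <= lower_reflected k.
Proof.
move=> a0; elim: i => [|i IH].
  rewrite /= le_max [a <= 0]leNgt a0 orbF; split=> [aZ|[j]].
    exists 0%N => //; split=> // k; rewrite leqn0 => /eqP ->.
    by apply: le_trans aZ _; rewrite gerBl.
  by rewrite leqn0 => /eqP -> [].
rewrite [upper_regulator _]/= !le_max [a <= 0]leNgt a0 orbF le_min; split.
  move=> /orP[/andP[/IH[j ji [aZ aZk]] aZi]|aZ].
    exists j; first exact: leqW.
    split=> // k /andP[jk]; rewrite leq_eqVlt => /predU1P[->//|ki].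
    by apply: aZk; rewrite jk.
  exists i.+1 => //; split=> // k; rewrite -eqn_leq => /eqP <-.
  by apply: le_trans aZ _; rewrite gerBl.
move=> [j]; rewrite leq_eqVlt => /predU1P[-> [-> _]|ji [aZ aZk]].
  by rewrite orbT.
apply/orP; left; apply/andP; split; last by apply: aZk; rewrite leqnn leqW.
by apply/IH; exists j => //; split=> // k /andP[jk ki]; apply: aZk; rewrite jk leqW.
Qed.

Lemma clamp_recursionE (v : nat -> R) : 0 <= y 0%N <= K -> v 0%N = y 0%N ->
  (forall i, v i.+1 = clamp K (v i + (y i.+1 - y i))) ->
  forall i, v i = lower_reflected i - upper_regulator i.
Proof.
move=> y0 v0 vS; elim=> [|i IH].
  rewrite v0 /= /lower_reflected /=.
  by case: (leP 0 (- y 0%N)) => ?; case: leP => ?; lra.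
have S0 := upper_regulator_ge0 i.
have ZS0 := lower_reflected_ge0 i.+1.
rewrite vS IH /=; move: ZS0; rewrite /lower_reflected /=.
move: (upper_regulator i) S0 (lower_regulator i) => S S0 L.
have -> : y i + L - S + (y i.+1 - y i) = y i.+1 + L - S by ring.
(* If the lower regulator becomes - y, the lower reflected value is 0 and both sides vanish;
   otherwise the step is [clamp_sub]. *)
case: (leP L (- y i.+1)) => [Ly _|_ yL0]; last exact: clamp_sub.
rewrite subrr !sub0r min_r // (max_r (_ : - K <= 0)) ?oppr_le0 // maxxx oppr0.
by rewrite /clamp max_r ?min_l //; lra.
Qed.

End skorokhod_recursion.

(** * Convergence of the recursion along a cadlag path *)

Section cadlag_blocks.
Variables (R : realType) (Y : R -> R) (e : R).
Hypotheses (cY : cadlag Y) (e0 : 0 < e).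

(* [b] numbers the blocks of a finite partition of [0, t[ into intervals of
   length at least [dl] on which [Y] oscillates by at most [e]. *)
Definition block_partition (t : R) (b : R -> nat) (dl : R) : Prop :=
  [/\ 0 < dl, exists M, forall u, 0 <= u < t -> (b u <= M)%N,
      forall u v, 0 <= u -> u <= v -> v < t -> (b u <= b v)%N,
      forall u v, 0 <= u < t -> 0 <= v < t -> b u = b v -> `|Y u - Y v| <= e &
      forall u, 0 <= u < t -> exists2 a, 0 <= a /\ a + dl <= t &
        forall v, a <= v < a + dl -> b v = b u].

Lemma block_partition_extend (s t : R) (b : R -> nat) (dl : R) :
  0 <= s -> s < t -> block_partition s b dl ->
  (forall u v, s <= u < t -> s <= v < t -> `|Y u - Y v| <= e) ->
  exists b' dl', block_partition t b' dl'.
Proof.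
move=> s0 st [dl0 [M bM] bmono bosc blen] osc.
exists (fun u => if u < s then b u else M.+1), (Num.min dl (t - s)).
split.
- by rewrite lt_min dl0 subr_gt0.
- exists M.+1 => u /andP[u0 ut]; case: ifPn => // us.
  by apply: leqW; apply: bM; rewrite u0.
- move=> u v u0 uv vt; case: ifPn => us; case: ifPn => vs //.
  + exact: bmono.
  + by apply: leqW; apply: bM; rewrite u0.
  + by move: us; rewrite (le_lt_trans uv vs).
- move=> u v /andP[u0 ut] /andP[v0 vt]; case: ifPn => us; case: ifPn => vs.
  + by apply: bosc; rewrite ?u0 ?v0.
  + by move=> bu; have := bM u; rewrite u0 us bu ltnn => /(_ isT).
  + by move=> bv; have := bM v; rewrite v0 vs -bv ltnn => /(_ isT).
  + by move=> _; apply: osc; rewrite ?ut ?vt andbT leNgt.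
- move=> u /andP[u0 ut]; case: ifPn => us.
    have [|a [a0 as_] ab] := blen u; first by rewrite u0.
    exists a.
      split=> //; apply: (@le_trans _ _ (a + dl)).
        by rewrite lerD2l ge_min lexx.
      by rewrite (le_trans as_) // ltW.
    move=> v /andP[av vad].
    have vd : v < a + dl by apply: lt_le_trans vad _; rewrite lerD2l ge_min lexx.
    by rewrite (lt_le_trans vd as_) ab // av.
  exists s; first by split=> //; rewrite -lerBrDl ge_min lexx orbT.
  by move=> v /andP[sv _]; rewrite ltNge sv.
Qed.

(** Compactness argument: let s be the supremum of the times up to which a partition exists. The
    left limit at s supplies a last block ending at s, so s is attained; right continuity at s would
    extend the partition further if s < T. *)
Lemma cadlag_block_partition (T : R) : 0 <= T ->
  exists b dl, block_partition T b dl.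
Proof.
move=> T0; have [rY lY] := cY.
pose A := [set t | 0 <= t <= T /\ exists b dl, block_partition t b dl].
have A0 : A 0.
  split; first by rewrite lexx.
  exists (fun=> 0%N), 1; split=> //.
  - by exists 0%N.
  - by move=> u v /andP[/le_lt_trans h /h]; rewrite ltxx.
  - by move=> u /andP[/le_lt_trans h /h]; rewrite ltxx.
have supA : has_sup A by split; [exists 0 | exists T => t [/andP[]]].
pose s := sup A.
have s0 : 0 <= s by apply: ub_le_sup => //; case: supA.
have sT : s <= T by apply: ge_sup; [exists 0 | move=> t [/andP[]]].
have As : A s.
  have [//|nAs] := pselect (A s).
  have /cvgrPdist_lt /(_ (e / 2)) := lY s.
  rewrite divr_gt0 // => /(_ isT) /nbhs_ballP[n /= n0 sn].
  have [t At snt] := sup_adherent n0 supA.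
  have ts : t < s.
    rewrite lt_neqAle; apply/andP; split.
      by apply/eqP => ts; apply: nAs; rewrite -ts.
    by apply: ub_le_sup => //; case: supA.
  case: (At) => /andP[t0 tT] [b [dl bp]].
  split; first by rewrite s0 sT.
  apply: (block_partition_extend t0 ts bp) => u v /andP[tu us] /andP[tv vs].
  have close w : t <= w -> w < s -> `|lim (Y @ s^'-) - Y w| < e / 2.
    move=> tw ws; apply: sn => //=; rewrite /ball /= ltr_distlC.
    by rewrite (lt_le_trans snt tw) (lt_trans ws) // ltrDl.
  have := close _ tu us; have := close _ tv vs; rewrite !ltr_norml ler_norml.
  by move=> /andP[? ?] /andP[? ?]; apply/andP; split; lra.
move: sT; rewrite le_eqVlt => /predU1P[<-|sltT]; first by case: As.
have /cvgrPdist_lt /(_ (e / 2)) := rY s.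
rewrite divr_gt0 // => /(_ isT) /nbhs_ballP[n /= n0 sn].
case: As => _ [b [dl bp]].
pose t := Num.min (s + n) T.
have st : s < t by rewrite lt_min sltT ltrDl n0.
suff At : A t.
  have : t <= s by apply: ub_le_sup => //; case: supA.
  by rewrite leNgt st.
split; first by rewrite (le_trans s0 (ltW st)) ge_min lexx orbT.
apply: (block_partition_extend s0 st bp) => u v /andP[su ut] /andP[sv vt].
have close w : s <= w -> w < t -> `|Y s - Y w| < e / 2.
  rewrite le_eqVlt => /predU1P[<-|sw] wt; first by rewrite subrr normr0 divr_gt0.
  have wn : w < s + n by apply: lt_le_trans wt _; rewrite ge_min lexx.
  apply: sn => //=; rewrite /ball /= ltr_distlC wn andbT.
  by rewrite (lt_trans _ sw) // ltrBlDr ltrDl.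
have := close _ su ut; have := close _ sv vt; rewrite !ltr_norml ler_norml.
by move=> /andP[? ?] /andP[? ?]; apply/andP; split; lra.
Qed.

End cadlag_blocks.

(** * Comparison of the reflection maps with the recursion on a grid *)

Section reflection_vs_recursion.
Variables (R : realType) (K T e : R) (Y : R -> R) (b : R -> nat).
Variables (tau : nat -> R) (N : nat).
Hypotheses (K0 : 0 <= K) (e0 : 0 <= e).
Hypothesis b_le : forall u v, 0 <= u -> u <= v -> v <= T -> (b u <= b v)%N.
Hypothesis b_osc : forall u v, 0 <= u <= T -> 0 <= v <= T -> b u = b v ->
  `|Y u - Y v| <= e.
Hypothesis tau_itv : forall i, (i <= N)%N -> 0 <= tau i <= T.
Hypothesis tau_le : forall i j, (i <= j)%N -> tau i <= tau j.
Hypothesis tauN : tau N = T.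
Hypothesis b_tau : forall u, 0 <= u <= T -> exists2 i, (i <= N)%N & b (tau i) = b u.

Let y (i : nat) : R := Y (tau i).
Let Z := lower_reflected y.
Let S := upper_regulator K y.
Let W := reflect_below Y.
Let regulator (t : R) := Num.max 0 (- inf [set Y u | u in `[0, t]]).

Let T0 : 0 <= T.
Proof. by rewrite -tauN; have /andP[] := tau_itv (leqnn N). Qed.

Let b_lt (u v : R) : 0 <= u <= T -> 0 <= v <= T -> (b u < b v)%N -> u < v.
Proof.
move=> /andP[u0 uT] /andP[v0 vT]; rewrite ltnNge ltNge; apply: contraNN => vu.
exact: b_le.
Qed.

Let bounded_path : exists B, forall u, 0 <= u <= T -> `|Y u| <= B.
Proof.
exists (\sum_(i < N.+1) `|y i| + e) => u uT.
have [i iN bu] := b_tau uT.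
have yY := b_osc (tau_itv iN) uT bu.
have : `|y i| <= \sum_(i < N.+1) `|y i|.
  have iN' : (i < N.+1)%N by [].
  by rewrite (bigD1 (Ordinal iN')) //= lerDl sumr_ge0.
have := ler_normB (y i) (y i - Y u).
by rewrite subKr -/(y i) in yY *; lra.
Qed.

Let lbound_path (s t : R) : 0 <= s -> t <= T -> has_lbound [set Y u | u in `[s, t]].
Proof.
move=> s0 tT; have [B YB] := bounded_path.
exists (- B) => _ /= [u + <-]; rewrite in_itv /= => /andP[su ut].
suff : `|Y u| <= B by rewrite ler_norml => /andP[].
by apply: YB; rewrite (le_trans s0 su) (le_trans ut tT).
Qed.

Let regulator_le (t a : R) : 0 <= t <= T ->
  regulator t <= a <-> 0 <= a /\ forall u, 0 <= u <= t -> - Y u <= a.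
Proof.
move=> /andP[t0 tT]; rewrite /regulator ge_max; split=> [/andP[a0 Ya]|[a0 Ya]].
  split=> // u ut; apply: le_trans Ya; rewrite lerN2.
  by apply: ge_inf; [exact: lbound_path | exists u => //=; rewrite in_itv].
rewrite a0 lerNl /=; apply: lb_le_inf.
  by exists (Y 0); exists 0 => //=; rewrite in_itv /= lexx.
by move=> _ /= [u + <-]; rewrite in_itv /= => ut; rewrite lerNl; exact: Ya.
Qed.

Let W_ge0 (t : R) : 0 <= t <= T -> 0 <= W t.
Proof.
move=> tT; have /(regulator_le _ tT)[_ /(_ t)] := lexx (regulator t).
have /andP[t0 _] := tT.
by rewrite t0 lexx => /(_ isT); rewrite /W /reflect_below -/(regulator t); lra.
Qed.

(** One [e] comes from the path and one from the regulator: each time up to u, and each grid time up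
    to [tau i], has a counterpart in the same block on the other side. *)
Lemma reflect_below_close (u : R) (i : nat) : 0 <= u <= T -> (i <= N)%N ->
  b (tau i) = b u -> `|W u - Z i| <= 2 * e.
Proof.
move=> uT iN bu; have e_ge0 := e0.
have yY := b_osc (tau_itv iN) uT bu.
have [L0 YL] := (regulator_le _ uT).1 (lexx (regulator u)).
have [l0 yl] := (lower_regulator_le y i _).1 (lexx (lower_regulator y i)).
have Ll : regulator u <= lower_regulator y i + e.
  apply/(regulator_le _ uT); split; first by lra.
  move=> v /andP[v0 vu].
  have vT : 0 <= v <= T by rewrite v0 (le_trans vu) //; case/andP: uT.
  have [j jN bv] := b_tau vT.
  suff [k ki bk] : exists2 k, (k <= i)%N & b (tau k) = b v.
    have := b_osc (tau_itv (leq_trans ki iN)) vT bk.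
    by rewrite ler_norml => /andP[_]; have := yl k ki; rewrite /y; lra.
  (* If the grid point representing v comes after [tau i], monotonicity of [b] puts v in the block
     of u, and i represents it too. *)
  have [ji|ij] := leqP j i; first by exists j.
  exists i => //; rewrite bu; apply/eqP; rewrite eqn_leq; apply/andP; split.
    rewrite -bv -bu; have /andP[i0 _] := tau_itv iN; have /andP[_ jT] := tau_itv jN.
    by apply: b_le => //; apply/tau_le/ltnW.
  by apply: b_le => //; case/andP: uT.
have lL : lower_regulator y i <= regulator u + e.
  apply/lower_regulator_le; split; first by lra.
  move=> j ji; have jN := leq_trans ji iN.
  have [bj|bj] := eqVneq (b (tau j)) (b u).
    have := b_osc (tau_itv jN) uT bj; rewrite ler_norml => /andP[+ _].
    have : - Y u <= regulator u by apply: YL; case/andP: uT => -> _ /=.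
    by rewrite /y; lra.
  have ju : tau j < u.
    apply: b_lt (tau_itv jN) uT _; rewrite ltn_neqAle bj -bu.
    have /andP[j0 _] := tau_itv jN; have /andP[_ iT] := tau_itv iN.
    by apply: b_le => //; exact: tau_le.
  have /andP[j0 _] := tau_itv jN.
  by have := YL (tau j); rewrite j0 (ltW ju) => /(_ isT); rewrite /y; lra.
move: yY; rewrite /W /reflect_below -/(regulator u) /Z /lower_reflected.
by rewrite !ler_norml -/(y i) => /andP[? ?]; apply/andP; split; lra.
Qed.

Let infW_le (s u : R) : 0 <= s -> s <= u <= T -> inf [set W u | u in `[s, T]] <= W u.
Proof.
move=> s0 suT; apply: ge_inf; last by exists u => //=; rewrite in_itv.
exists 0 => _ /= [v + <-]; rewrite in_itv /= => /andP[sv vT].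
by apply: W_ge0; rewrite (le_trans s0 sv).
Qed.

Let G (s : R) := Num.min (Num.max (W s - K) 0) (inf [set W u | u in `[s, T]]).

Let G_sup (s : R) : 0 <= s <= T -> G s <= sup [set G s | s in `[0, T]].
Proof.
move=> sT; apply: ub_le_sup; last by exists s => //=; rewrite in_itv.
exists (W T) => _ /= [u + <-]; rewrite in_itv /= => /andP[u0 uT].
by rewrite ge_min infW_le ?orbT // uT lexx.
Qed.

(** The bound is 2 e for the lower reflected value at T plus 2 e for the upper regulators. The
    latter are compared through witnesses: one for the supremum yields a grid witness in the same
    block at a level lower by 2 e, and conversely. *)
Lemma reflection_close :
  `|reflect_above K (reflect_below Y) T - (Z N - S N)| <= 4 * e.
Proof.
have e_ge0 := e0; have TT : 0 <= T <= T by rewrite T0 lexx.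
have WZ : `|W T - Z N| <= 2 * e by apply: reflect_below_close => //; rewrite tauN.
have S0 : 0 <= S N by exact: upper_regulator_ge0.
have supS : sup [set G s | s in `[0, T]] <= S N + 2 * e.
  apply: ge_sup; first by exists (G 0); exists 0 => //=; rewrite in_itv /= lexx.
  move=> _ /= [s + <-]; rewrite in_itv /= => sT.
  have [le0|gt0] := leP (G s - 2 * e) 0; first by lra.
  suff : G s - 2 * e <= S N by lra.
  apply/(upper_regulator_ge _ K0 _ gt0).
  have [i iN bi] := b_tau sT.
  have s0 : 0 <= s by case/andP: sT.
  have GW u : s <= u <= T -> G s <= W u.
    by move=> su; rewrite ge_min infW_le ?orbT.
  exists i => //; split.
    have : G s <= Num.max (W s - K) 0 by rewrite ge_min lexx.
    have := reflect_below_close sT iN bi; rewrite ler_norml -/Z => /andP[_].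
    by case: (leP (W s - K) 0) => ?; lra.
  move=> k /andP[ik kN].
  have [bk|bk] := eqVneq (b (tau k)) (b s).
    have := reflect_below_close sT kN bk; rewrite ler_norml -/Z => /andP[_].
    by have := GW s; rewrite lexx; case/andP: sT => _ -> /(_ isT); lra.
  have sk : s < tau k.
    apply: b_lt sT (tau_itv kN) _; rewrite ltn_neqAle eq_sym bk -bi.
    have /andP[i0 _] := tau_itv iN; have /andP[_ kT] := tau_itv kN.
    by apply: b_le => //; exact: tau_le.
  have := reflect_below_close (tau_itv kN) kN erefl.
  rewrite ler_norml -/Z => /andP[_]; have := GW (tau k).
  by rewrite (ltW sk); case/andP: (tau_itv kN) => _ -> /(_ isT); lra.
have Ssup : S N <= sup [set G s | s in `[0, T]] + 2 * e.
  have sup0 : 0 <= sup [set G s | s in `[0, T]].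
    apply: le_trans (G_sup TT); rewrite le_min le_max lexx orbT /=.
    apply: lb_le_inf; first by exists (W T); exists T => //=; rewrite in_itv /= lexx.
    move=> _ /= [u + <-]; rewrite in_itv /= => /andP[Tu uT].
    by apply: W_ge0; rewrite (le_trans T0 Tu).
  have [le0|gt0] := leP (S N) 0; first by lra.
  have [j jN [Zj Zk]] := (upper_regulator_ge y K0 N gt0).1 (lexx _).
  have jT := tau_itv jN.
  suff : S N - 2 * e <= G (tau j) by have := G_sup jT; lra.
  rewrite le_min; apply/andP; split.
    have := reflect_below_close jT jN erefl; rewrite ler_norml => /andP[+ _].
    by rewrite le_max; move: Zj; rewrite -/Z -/S => ? ?; apply/orP; left; lra.
  apply: lb_le_inf.
    by exists (W (tau j)); exists (tau j) => //=; rewrite in_itv /= lexx; case/andP: jT.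
  move=> _ /= [v + <-]; rewrite in_itv /= => /andP[jv vT].
  have vT' : 0 <= v <= T by rewrite vT andbT (le_trans _ jv) //; case/andP: jT.
  suff [k /andP[jk kN] bk] : exists2 k, (j <= k <= N)%N & b (tau k) = b v.
    have := reflect_below_close vT' kN bk; rewrite ler_norml => /andP[+ _].
    by have := Zk k; rewrite jk kN -/Z -/S => /(_ isT); lra.
  have [i iN bi] := b_tau vT'.
  have [ji|ij] := leqP j i; first by exists i => //; rewrite ji.
  exists j; first by rewrite leqnn.
  apply/eqP; rewrite eqn_leq; apply/andP; split.
    by apply: b_le => //; case/andP: jT.
  rewrite -bi; apply: b_le; first by case/andP: (tau_itv iN).
    exact/tau_le/ltnW.
  by case/andP: jT.
move: WZ; rewrite /reflect_above -/W -/G !ler_norml => /andP[? ?].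
by apply/andP; split; lra.
Qed.

End reflection_vs_recursion.

(* The scheme need only know that its grid is fine: each block of the partition
   is longer than the mesh, hence contains a grid point. *)
Lemma reflection_approx (R : realType) (K T e : R) (Y : R -> R) :
  0 <= K -> 0 <= T -> 0 < e -> cadlag Y -> 0 <= Y 0 <= K ->
  exists2 dl, 0 < dl & forall (tau v : nat -> R) (N : nat),
    tau 0%N = 0 -> tau N = T -> (forall i, 0 <= tau i.+1 - tau i < dl) ->
    v 0%N = Y 0 ->
    (forall i, v i.+1 = clamp K (v i + (Y (tau i.+1) - Y (tau i)))) ->
    `|reflect_above K (reflect_below Y) T - v N| <= e.
Proof.
move=> K0 T0 e0 cY Y0K.
have e4 : 0 < e / 4 by rewrite divr_gt0.
have [b [dl [dl0 [M bM] bmono bosc blen]]] := cadlag_block_partition cY e4 T0.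
exists dl => // tau v N tau0 tauN mesh v0 vS.
(* The partition covers [0, T[ only; the endpoint T, where the path may jump, gets a block of its
   own. *)
pose b' u := if u < T then b u else M.+1.
have tau_le i j : (i <= j)%N -> tau i <= tau j.
  move: i j; apply: (homo_leq (r := <=%R)) => [//|x y z|k]; first exact: le_trans.
  by have /andP[] := mesh k; rewrite subr_ge0.
have tau_itv i : (i <= N)%N -> 0 <= tau i <= T.
  by move=> iN; rewrite -tau0 -tauN !tau_le.
rewrite (@clamp_recursionE _ K (Y \o tau)) //= ?tau0 //.
have -> : e = 4 * (e / 4) by lra.
apply: (@reflection_close _ K T _ Y b') => //; first exact: ltW.
- move=> u w u0 uw wT; rewrite /b'; case: ifPn => uT; case: ifPn => wT' //.
  + exact: bmono.
  + by apply: leqW; apply: bM; rewrite u0.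
  + by move: uT; rewrite (le_lt_trans uw wT').
- move=> u w /andP[u0 uT] /andP[w0 wT]; rewrite /b'.
  case: ifPn => uT'; case: ifPn => wT'.
  + by apply: bosc; rewrite ?u0 ?w0.
  + by move=> bu; have := bM u; rewrite u0 uT' bu ltnn => /(_ isT).
  + by move=> bw; have := bM w; rewrite w0 wT' -bw ltnn => /(_ isT).
  + move=> _; have -> : u = T by apply/eqP; rewrite eq_le uT leNgt.
    have -> : w = T by apply/eqP; rewrite eq_le wT leNgt.
    by rewrite subrr normr0 ltW.
- move=> u /andP[u0 uT]; rewrite /b'; case: ifPn => uT'; last first.
    by exists N => //; rewrite tauN ltxx.
  have [|a [a0 aT] ab] := blen u; first by rewrite u0.
  have aN : a <= tau N by rewrite tauN (le_trans _ aT) // lerDl ltW.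
  have ex : exists i, a <= tau i by exists N.
  have iN : (ex_minn ex <= N)%N by case: ex_minnP => m _; exact.
  (* The first grid point at or after a is less than [dl] beyond a: either it is the origin or its
     predecessor lies before a. *)
  exists (ex_minn ex) => //.
  have : a <= tau (ex_minn ex) < a + dl.
    case: ex_minnP => -[|m] am mmin.
      by rewrite am tau0 (le_lt_trans a0) // ltrDl.
    have : tau m < a by rewrite ltNge; apply/negP => /mmin; rewrite ltnn.
    by have /andP[? ?] := mesh m; rewrite am /=; lra.
  move=> /[dup] /andP[_ lt] /ab ->.
  by rewrite (lt_le_trans lt aT).
Qed.

(** * Bounded random variables and independence *)

Section bounded_integrals.
Context d (T : measurableType d) (R : realType) (P : probability T R).

Lemma bounded_integrable (f : T -> R) (B : R) : measurable_fun setT f ->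
  (forall w, `|f w| <= B) -> P.-integrable setT (EFin \o f).
Proof.
move=> mf fB; apply: measurable_bounded_integrable => //.
  exact: le_lt_trans (probability_le1 P measurableT) (ltry _).
exists B; split; first exact: num_real.
by move=> M BM w _ /=; apply: le_trans (fB w) (ltW BM).
Qed.

Lemma Rintegral_probability_cst (r : R) : \int[P]_w r = r.
Proof.
rewrite Rintegral_cst //; set p := (X in fine X).
by have -> : p = 1%E := probability_setT P; rewrite mulr1.
Qed.

(** Independence on rectangles makes the joint law of U and V the product of their laws, so Fubini
    applies; both integrals are then pulled back to the original space. *)
Lemma Rintegral_independent d1 d2 (T1 : measurableType d1) (T2 : measurableType d2)
    (U : {RV P >-> T1}) (V : {RV P >-> T2}) (F : T1 * T2 -> R) (B : R) :
  (forall A C, measurable A -> measurable C ->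
    P (U @^-1` A `&` V @^-1` C) = (P (U @^-1` A) * P (V @^-1` C))%E) ->
  measurable_fun setT F -> (forall z, `|F z| <= B) ->
  \int[P]_w F (U w, V w) = \int[P]_w (\int[P]_w' F (U w, V w')).
Proof.
move=> indep mF FB.
have mUV : measurable_fun setT (fun w => (U w, V w)).
  by apply: measurable_fun_pair.
pose UV := MeasurableFun.Pack
  (MeasurableFun.Class (isMeasurableFun.Build _ _ _ _ _ mUV)).
have joint A : measurable A ->
    (distribution P U \x distribution P V)%E A = distribution P UV A.
  by move=> mA; apply: product_measure_unique => // A' C' mA' mC'; exact: indep.
have /measurable_EFinP mFE := mF.
have int1 : P.-integrable setT (fun w => (F (U w, V w))%:E).
  exact: (bounded_integrable (measurableT_comp mF mUV) (fun w => FB (U w, V w))).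
have int2 : (distribution P U \x distribution P V)%E.-integrable setT (fun z => (F z)%:E).
  apply/integrableP; split=> //.
  rewrite (@eq_measure_integral _ _ _ _ (distribution P UV)); last first.
    by move=> A mA _; exact: joint.
  rewrite ge0_integral_distribution //; last by apply: measurableT_comp.
  by have /integrableP[] := int1.
rewrite /Rintegral; congr fine.
transitivity (\int[distribution P UV]_z (F z)%:E)%E.
  by rewrite integral_distribution.
transitivity (\int[distribution P U \x distribution P V]_z (F z)%:E)%E.
  by apply/esym/eq_measure_integral => A mA _; exact: joint.
rewrite -integral12_prod_meas1 //.
have mFx x : measurable_fun setT (fun w => F (x, V w)).
  exact: (measurableT_comp mF (measurableT_comp (pair1_measurable x) (measurable_funPT V))).
have bound x : P.-integrable setT (fun w => (F (x, V w))%:E).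
  exact: (bounded_integrable (mFx x) (fun w => FB (x, V w))).
have inner x : fubini_F (distribution P V) (EFin \o F) x =
    (\int[P]_w' F (x, V w'))%:E.
  rewrite /fubini_F integral_distribution //.
    by rewrite /Rintegral fineK //; exact: (integrable_fin_num _ (bound x)).
    by apply/measurable_EFinP; exact: (measurableT_comp mF (pair1_measurable x)).
  exact: bound.
transitivity (\int[distribution P U]_x (\int[P]_w' F (x, V w'))%:E)%E.
  by apply: eq_integral => x _; exact: inner.
have mG : measurable_fun setT (fun x => \int[P]_w' F (x, V w')).
  by apply/measurable_EFinP; have := measurable_fubini_F int2; rewrite (funext inner).
have GB x : `|\int[P]_w' F (x, V w')| <= B.
  apply: le_trans (le_normr_Rintegral measurableT (bound x)) _.
  rewrite -[leRHS]Rintegral_probability_cst; apply: le_Rintegral => //.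
    exact/integrable_norm/bound.
  by apply: (@bounded_integrable (fun=> B) `|B|).
rewrite integral_distribution //; first exact/measurable_EFinP.
exact: (bounded_integrable (measurableT_comp mG (measurable_funPT U)) (fun w => GB (U w))).
Qed.

Lemma same_law_Rintegral (Y Z : T -> R) (f : R -> R) (B : R) :
  measurable_fun setT Y -> measurable_fun setT Z -> same_law P Y Z ->
  measurable_fun setT f -> (forall x, `|f x| <= B) ->
  \int[P]_w f (Y w) = \int[P]_w f (Z w).
Proof.
move=> mY mZ YZ mf fB.
pose Y' : {RV P >-> R} := MeasurableFun.Pack
  (MeasurableFun.Class (isMeasurableFun.Build _ _ _ _ _ mY)).
pose Z' : {RV P >-> R} := MeasurableFun.Pack
  (MeasurableFun.Class (isMeasurableFun.Build _ _ _ _ _ mZ)).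
have mfE : measurable_fun setT (EFin \o f) by exact/measurable_EFinP.
rewrite /Rintegral; congr fine.
transitivity (\int[distribution P Y']_x (f x)%:E)%E.
  rewrite integral_distribution //.
  exact: (bounded_integrable (measurableT_comp mf mY) (fun w => fB (Y w))).
transitivity (\int[distribution P Z']_x (f x)%:E)%E.
  by apply: eq_measure_integral => A mA _; exact: YZ.
rewrite integral_distribution //.
exact: (bounded_integrable (measurableT_comp mf mZ) (fun w => fB (Z w))).
Qed.

Definition bounded_rv (f : T -> R) : Prop :=
  measurable_fun setT f /\ exists B, forall w, `|f w| <= B.

Lemma bounded_rv_integrable f : bounded_rv f -> P.-integrable setT (EFin \o f).
Proof. by move=> [mf [B fB]]; exact: bounded_integrable fB. Qed.

Lemma bounded_rv_cst (r : R) : bounded_rv (fun=> r).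
Proof. by split; [exact: measurable_cst | exists `|r|]. Qed.

Lemma bounded_rvD f g : bounded_rv f -> bounded_rv g -> bounded_rv (fun w => f w + g w).
Proof.
move=> [mf [B fB]] [mg [C gC]]; split; first exact: measurable_funD.
by exists (B + C) => w; apply: le_trans (ler_normD _ _) _; exact: lerD.
Qed.

Lemma bounded_rvM f g : bounded_rv f -> bounded_rv g -> bounded_rv (fun w => f w * g w).
Proof.
move=> [mf [B fB]] [mg [C gC]]; split; first exact: measurable_funM.
by exists (B * C) => w; rewrite normrM ler_pM.
Qed.

Lemma bounded_rvB f g : bounded_rv f -> bounded_rv g -> bounded_rv (fun w => f w - g w).
Proof.
move=> [mf [B fB]] [mg [C gC]]; split; first exact: measurable_funB.
by exists (B + C) => w; apply: le_trans (ler_normB _ _) _; exact: lerD.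
Qed.

Lemma bounded_RintegralD f g : bounded_rv f -> bounded_rv g ->
  \int[P]_w (f w + g w) = \int[P]_w f w + \int[P]_w g w.
Proof. by move=> /bounded_rv_integrable ? /bounded_rv_integrable ?; rewrite RintegralD. Qed.

Lemma bounded_RintegralB f g : bounded_rv f -> bounded_rv g ->
  \int[P]_w (f w - g w) = \int[P]_w f w - \int[P]_w g w.
Proof. by move=> /bounded_rv_integrable ? /bounded_rv_integrable ?; rewrite RintegralB. Qed.

Lemma bounded_RintegralZl f (r : R) : bounded_rv f ->
  \int[P]_w (r * f w) = r * \int[P]_w f w.
Proof. by move=> /bounded_rv_integrable ?; rewrite RintegralZl. Qed.

Lemma bounded_le_Rintegral f g : bounded_rv f -> bounded_rv g ->
  (forall w, f w <= g w) -> \int[P]_w f w <= \int[P]_w g w.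
Proof.
by move=> /bounded_rv_integrable ? /bounded_rv_integrable ? fg; exact: le_Rintegral.
Qed.

End bounded_integrals.

(** * The grid scheme and its Markov property *)

Section euler_scheme.
Context (R : realType) d (T : measurableType d) (P : probability T R).
Variables (K : R) (X Q : R -> {RV P >-> R}).

(** The list holds step lengths. Past its end the default 0 freezes the grid, which is thus
    nondecreasing over all indices once the steps are nonnegative. *)
Definition grid (ds : seq R) (i : nat) : R := \sum_(j < i) ds`_j.

Definition increment (ds : seq R) (i : nat) (w : T) : R :=
  X (grid ds i.+1) w - X (grid ds i) w.

Fixpoint scheme (ds : seq R) (i : nat) (w : T) : R :=
  if i is j.+1 then clamp K (scheme ds j w + increment ds j w) else Q 0 w.

(** Cylinder sets: closed under intersection, they generate the sigma-algebra of [Q 0] and the first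
    i increments. *)
Definition past (ds : seq R) (i : nat) : set (set T) :=
  [set A | exists2 C : set R * (nat -> set R),
    measurable C.1 /\ (forall j, measurable (C.2 j)) &
    A = Q 0 @^-1` C.1 `&` [set w | forall j, (j < i)%N -> C.2 j (increment ds j w)]].

Lemma grid0 ds : grid ds 0 = 0.
Proof. by rewrite /grid big_ord0. Qed.

Lemma gridS ds i : grid ds i.+1 = grid ds i + ds`_i.
Proof. by rewrite /grid big_ord_recr. Qed.

Section independence.
Hypotheses (hX : levy_process X) (hQ : stationary_workload K X Q).
Variable ds : seq R.
Hypothesis ds_ge0 : forall i, 0 <= ds`_i.

Lemma grid_le i j : (i <= j)%N -> grid ds i <= grid ds j.
Proof.
move: i j; apply: (homo_leq (r := <=%R)) => [//|x y z|i]; first exact: le_trans.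
by rewrite gridS lerDl.
Qed.

Lemma measurable_increment i : measurable_fun setT (increment ds i).
Proof. by apply: measurable_funB; exact: measurable_funPT. Qed.

(** Two independences are chained: [Q 0] against the process at nonnegative times, where the grid
    lives, then the increments among themselves. *)
Lemma cylinder_probability i (C0 : set R) (C : nat -> set R) :
  measurable C0 -> (forall j, measurable (C j)) ->
  P (Q 0 @^-1` C0 `&` [set w | forall j, (j < i)%N -> C j (increment ds j w)]) =
  (P (Q 0 @^-1` C0) * \prod_(j < i) P (increment ds j @^-1` C j))%E.
Proof.
move=> mC0 mC.
have -> : [set w | forall j, (j < i)%N -> C j (increment ds j w)] =
    [set w | forall j : 'I_i, C j (increment ds j w)].
  apply/seteqP; split=> w /= Cw => [j|j ji]; first exact: Cw.
  exact: (Cw (Ordinal ji)).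
have grid_homo : {homo grid ds : k l / (k <= l)%N >-> k <= l} by exact: grid_le.
rewrite -(levy_independent_increments hX grid_homo (fun j : 'I_i => mC j)).
apply: (workload_independent hQ) => //.
pose G := \bigcup_(t in [set t : R | 0 <= t])
  preimage_set_system setT (X t : T -> R) measurable.
have mX t : 0 <= t ->
    measurable_fun (setT : set (g_sigma_algebraType G)) (X t : g_sigma_algebraType G -> R).
  move=> t0 _ B mB; apply: sub_sigma_algebra; exists t => //.
  by exists B.
have -> : [set w | forall j : 'I_i, C j (increment ds j w)] =
    \bigcap_(j in [set: 'I_i]) (increment ds j @^-1` C j).
  by apply/seteqP; split=> w /= Cw j; [move=> _; exact: Cw | exact: (Cw j)].
apply: (@fin_bigcap_measurable _ (g_sigma_algebraType G)); first exact: finite_finset.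
move=> j _; rewrite -[X in measurable X]setTI.
suff : measurable_fun (setT : set (g_sigma_algebraType G))
  (increment ds j : g_sigma_algebraType G -> R) by apply; [exact: measurableT | exact: mC].
have grid_ge0 k : 0 <= grid ds k by rewrite -(grid0 ds) grid_le.
by apply: measurable_funB; apply: mX.
Qed.

(** For a fixed event E of the next increment, P restricted to E and P scaled by P E are finite
    measures that agree on the cylinders, hence on the sigma-algebra these generate. *)
Lemma past_independent i (A : set T) (C : set R) : <<s past ds i >> A ->
  measurable C ->
  P (A `&` increment ds i @^-1` C) = (P A * P (increment ds i @^-1` C))%E.
Proof.
move=> sA mC; set E := increment ds i @^-1` C.
have mE : measurable E.
  by rewrite -[E]setTI; exact: measurable_increment.
pose m1 := mrestr P mE.
pose m2 := mscale (NngNum (fine_ge0 (measure_ge0 P E))) P.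
suff m12 : m1 A = m2 A.
  by rewrite -[LHS]/(m1 A) m12 /m2 /mscale /= fineK ?fin_num_measure // muleC.
have past_meas B : past ds i B -> measurable B.
  move=> [[C0 Cj] /= [mC0 mCj] ->]; apply: measurableI.
    by rewrite -[X in measurable X]setTI; exact: measurable_funPT.
  have -> : [set w | forall j, (j < i)%N -> Cj j (increment ds j w)] =
      \bigcap_(j in [set j | (j < i)%N]) (increment ds j @^-1` Cj j).
    by apply/seteqP; split.
  apply: bigcap_measurableType => j _.
  by rewrite -[X in measurable X]setTI; exact: measurable_increment.
apply: (g_sigma_algebra_measure_unique (past ds i) past_meas (fun=> setT)) => //.
- move=> _; exists (setT, fun=> setT); first by split=> *; exact: measurableT.
  by apply/seteqP; split.
- by apply/seteqP; split=> // w _; exists 0%N.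
- move=> _ _ [C1 [mC1 mC1'] ->] [C2 [mC2 mC2'] ->].
  exists (C1.1 `&` C2.1, fun j => C1.2 j `&` C2.2 j).
    by split=> [|j]; apply: measurableI.
  apply/seteqP; split=> w /=.
    by move=> [[? C1w] [? C2w]]; split=> // j ji; split; [exact: C1w | exact: C2w].
  by move=> [[? ?] C12]; split; split=> // j /C12[].
- move=> _ [[C0 Cj] /= [mC0 mCj] ->].
  pose Cj' j := if j == i then C else Cj j.
  have mCj' j : measurable (Cj' j) by rewrite /Cj'; case: ifPn.
  rewrite /m1 /m2 /mrestr /mscale /= fineK ?fin_num_measure // -setIA.
  have -> : [set w | forall j, (j < i)%N -> Cj j (increment ds j w)] `&` E =
      [set w | forall j, (j < i.+1)%N -> Cj' j (increment ds j w)].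
    apply/seteqP; split=> w /=.
      move=> [Cw Ew] j; rewrite ltnS leq_eqVlt /Cj' => /predU1P[->|ji].
        by rewrite eqxx.
      by rewrite ltn_eqF //; exact: Cw.
    move=> Cw; split; last by have := Cw i (leqnn _); rewrite /Cj' eqxx.
    by move=> j ji; have := Cw j (leqW ji); rewrite /Cj' ltn_eqF.
  rewrite !cylinder_probability // big_ord_recr /= {2}/Cj' eqxx muleA muleC.
  congr (_ * (_ * _))%E; apply: eq_bigr => j _.
  by rewrite /Cj' ltn_eqF.
- by move=> k; rewrite /m1 -ge0_fin_numE ?fin_num_measure.
Qed.

Lemma measurable_past_increment i j : (j < i)%N ->
  measurable_fun (setT : set (g_sigma_algebraType (past ds i)))
    (increment ds j : g_sigma_algebraType (past ds i) -> R).
Proof.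
move=> ji _ C mC; rewrite setTI; apply: sub_sigma_algebra.
exists (setT, fun k => if k == j then C else setT).
  split; first exact: measurableT.
  by move=> k /=; case: ifPn => // _; exact: measurableT.
rewrite preimage_setT setTI; apply/seteqP; split=> w /=.
  by move=> Cw k ki; case: eqP => // ->.
by move=> /(_ j ji); rewrite eqxx.
Qed.

Lemma measurable_past_initial i :
  measurable_fun (setT : set (g_sigma_algebraType (past ds i)))
    (Q 0 : g_sigma_algebraType (past ds i) -> R).
Proof.
move=> _ C mC; rewrite setTI; apply: sub_sigma_algebra.
exists (C, fun=> setT); first by split=> // j; exact: measurableT.
by apply/seteqP; split=> w //= [].
Qed.

Lemma measurable_past_scheme i j : (j <= i)%N ->
  measurable_fun (setT : set (g_sigma_algebraType (past ds i)))
    (scheme ds j : g_sigma_algebraType (past ds i) -> R).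
Proof.
elim: j => [_|j IH ji]; first exact: measurable_past_initial.
apply: (measurableT_comp (measurable_clamp K)); apply: measurable_funD.
  exact: (IH (ltnW ji)).
exact: measurable_past_increment.
Qed.

Lemma measurable_scheme i : measurable_fun setT (scheme ds i).
Proof.
elim: i => [|i IH]; first exact: measurable_funPT.
apply: (measurableT_comp (measurable_clamp K)); apply: measurable_funD => //.
exact: measurable_increment.
Qed.

(** Transition operator of a grid step of length s; by stationarity and X_0 = 0, X_s has the law of
    any increment over that length. *)
Definition kernel_step (s : R) (g : R -> R) (x : R) : R :=
  \int[P]_w g (clamp K (x + X s w)).

(** [Q 0] and the current value both belong to the past, so the next increment can be integrated out
    with the pair frozen. The factor rho carries the dependence on [Q 0] that covariances
    require. *)
Lemma scheme_step i (rho g : R -> R) (B : R) :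
  measurable_fun setT rho -> measurable_fun setT g ->
  (forall x, `|rho x| <= B) -> (forall x, `|g x| <= B) ->
  \int[P]_w (rho (Q 0 w) * g (scheme ds i.+1 w)) =
  \int[P]_w (rho (Q 0 w) * kernel_step ds`_i g (scheme ds i w)).
Proof.
move=> mrho mg rhoB gB.
have mU : measurable_fun setT (fun w => (Q 0 w, scheme ds i w)).
  exact: (measurable_fun_pair (measurable_funPT (Q 0)) (measurable_scheme i)).
pose U := MeasurableFun.Pack (MeasurableFun.Class (isMeasurableFun.Build _ _ _ _ _ mU)).
pose V := MeasurableFun.Pack (MeasurableFun.Class
  (isMeasurableFun.Build _ _ _ _ _ (measurable_increment i))).
pose F (z : R * R * R) := rho z.1.1 * g (clamp K (z.1.2 + z.2)).
have mF : measurable_fun setT F.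
  apply: measurable_funM.
    exact: (measurableT_comp mrho (measurableT_comp measurable_fst measurable_fst)).
  apply: (measurableT_comp mg); apply: (measurableT_comp (measurable_clamp K)).
  apply: measurable_funD; last exact: measurable_snd.
  exact: (measurableT_comp measurable_snd measurable_fst).
have FB z : `|F z| <= B * B by rewrite normrM ler_pM.
transitivity (\int[P]_w F (U w, V w)); first by [].
rewrite (Rintegral_independent (U := U) (V := V) (F := F) (B := B * B)) //; last first.
  move=> A C mA mC; apply: past_independent => //.
  have := measurable_fun_pair (@measurable_past_initial i) (measurable_past_scheme (leqnn i)).
  by move=> /(_ measurableT A mA); rewrite setTI.
apply: eq_Rintegral => w _; rewrite /F /=.
have mgx (x : R) : measurable_fun setT (fun z : R => g (clamp K (x + z))).
  apply: (measurableT_comp mg); apply: (measurableT_comp (measurable_clamp K)).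
  by apply: measurable_funD => //; exact: measurable_cst.
rewrite RintegralZl //; last first.
  apply: (@bounded_integrable _ _ _ _ _ B) => // .
  exact: (measurableT_comp (mgx _) (measurable_increment i)).
congr (_ * _); rewrite /kernel_step.
pose h z := g (clamp K (scheme ds i w + z)).
apply: (same_law_Rintegral (f := h) (measurable_increment i) (measurable_funPT (X ds`_i))
  _ (mgx _) (fun z => gB _)) => C mC.
rewrite /increment gridS [grid ds i + _]addrC.
have := levy_stationary_increments hX (grid ds i) (ds_ge0 i) mC.
rewrite add0r => ->; congr (P _).
by apply/seteqP; split=> w' /=; rewrite (levy_at0 hX) subr0.
Qed.

End independence.
End euler_scheme.

(** * Transition operators and the Markov property of the scheme *)

Section kernels.
Context (R : realType) d (T : measurableType d) (P : probability T R).
Variables (K : R) (X Q : R -> {RV P >-> R}).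
Hypothesis K0 : 0 <= K.

(** A class stable under [kernel_step] and containing [clamp K], which acts as the identity on
    [0, K]. *)
Definition tame (g : R -> R) : Prop :=
  (forall x, 0 <= g x <= K) /\ forall x y, x <= y -> 0 <= g y - g x <= y - x.

Definition kernel_iter (ds : seq R) (g : R -> R) : R -> R :=
  foldr (kernel_step K X) g ds.

Lemma tame_measurable g : tame g -> measurable_fun setT g.
Proof.
move=> [_ gxy]; apply: nondecreasing_measurable => // x y /gxy /andP[].
by rewrite subr_ge0.
Qed.

Lemma tame_bounded g : tame g -> forall x, `|g x| <= K.
Proof. by move=> [gK _] x; have /andP[g0 ?] := gK x; rewrite ger0_norm. Qed.

Lemma clamp_tame : tame (clamp K).
Proof.
split=> [x|x y xy]; first exact: clamp_itv.
by rewrite subr_ge0 clamp_le //= clamp_contract.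
Qed.

Lemma tame_kernel_bounded_rv g s x : tame g ->
  bounded_rv (fun w => g (clamp K (x + X s w))).
Proof.
move=> tg; split; last by exists K => w; exact: tame_bounded.
apply: (measurableT_comp (tame_measurable tg)).
apply: (measurableT_comp (tame_measurable clamp_tame)).
exact: (measurable_funD (measurable_cst x) (measurable_funPT (X s))).
Qed.

(** The slack c serves both halves of [kernel_step_tame]: c = 0 for monotonicity, c = y - x for the
    Lipschitz bound. *)
Lemma le_kernel_step g s x1 x2 c : tame g ->
  (forall w, g (clamp K (x1 + X s w)) <= g (clamp K (x2 + X s w)) + c) ->
  kernel_step K X s g x1 <= kernel_step K X s g x2 + c.
Proof.
move=> tg gc; rewrite /kernel_step -[c in leRHS](Rintegral_probability_cst P).
rewrite -bounded_RintegralD; [|exact: tame_kernel_bounded_rv|exact: bounded_rv_cst].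
apply: bounded_le_Rintegral => //; first exact: tame_kernel_bounded_rv.
by apply: bounded_rvD; [exact: tame_kernel_bounded_rv | exact: bounded_rv_cst].
Qed.

Lemma kernel_step_tame g s : tame g -> tame (kernel_step K X s g).
Proof.
move=> tg; have [gK gxy] := tg; split=> [x|x y xy].
  apply/andP; split.
    by apply: Rintegral_ge0 => w _; case/andP: (gK (clamp K (x + X s w))).
  rewrite -[leRHS](Rintegral_probability_cst P); apply: bounded_le_Rintegral.
  - exact: tame_kernel_bounded_rv.
  - exact: bounded_rv_cst.
  - by move=> w; case/andP: (gK (clamp K (x + X s w))).
have cxy w : clamp K (x + X s w) <= clamp K (y + X s w).
  by apply: clamp_le; rewrite lerD2r.
apply/andP; split.
  rewrite subr_ge0 -[leRHS]addr0; apply: le_kernel_step => // w.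
  by rewrite addr0 -subr_ge0; have /andP[] := gxy _ _ (cxy w).
rewrite lerBlDl; apply: le_kernel_step => // w.
have /andP[_ ?] := gxy _ _ (cxy w).
have : x + X s w <= y + X s w by rewrite lerD2r.
by move=> /(clamp_contract K) ?; lra.
Qed.

Lemma kernel_iter_tame ds g : tame g -> tame (kernel_iter ds g).
Proof. by move=> tg; elim: ds => //= s ds; exact: kernel_step_tame. Qed.

Lemma kernel_step_diff g1 g2 s : tame g1 -> tame g2 ->
  (forall x y, 0 <= x -> x <= y -> y <= K -> g1 x - g2 x <= g1 y - g2 y) ->
  forall x y, x <= y -> kernel_step K X s g1 x - kernel_step K X s g2 x <=
                        kernel_step K X s g1 y - kernel_step K X s g2 y.
Proof.
move=> t1 t2 g12 x y xy; rewrite /kernel_step.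
rewrite -!bounded_RintegralB; try exact: tame_kernel_bounded_rv.
apply: bounded_le_Rintegral; try by apply: bounded_rvB; exact: tame_kernel_bounded_rv.
move=> w; apply: g12; last by case/andP: (clamp_itv K0 (y + X s w)).
  by case/andP: (clamp_itv K0 (x + X s w)).
by apply: clamp_le; rewrite lerD2r.
Qed.

(** With no step in ds1 the difference is x - g(x) for a 1-Lipschitz g, hence nondecreasing; each
    step of ds1 averages it along monotone maps into [0, K], which preserves monotonicity. *)
Lemma kernel_iter_diff ds1 ds2 x y : 0 <= x -> x <= y -> y <= K ->
  kernel_iter ds1 (clamp K) x - kernel_iter (ds1 ++ ds2) (clamp K) x <=
  kernel_iter ds1 (clamp K) y - kernel_iter (ds1 ++ ds2) (clamp K) y.
Proof.
rewrite /kernel_iter foldr_cat -!/(kernel_iter _ _).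
elim: ds1 x y => [|s ds1 IH] x y x0 xy yK /=.
  have [_ /(_ x y xy) /andP[_]] := kernel_iter_tame ds2 clamp_tame.
  have -> : clamp K x = x by rewrite clamp_id // x0 (le_trans xy).
  have -> : clamp K y = y by rewrite clamp_id // yK (le_trans x0).
  by move=> ?; lra.
apply: kernel_step_diff => //; try exact/kernel_iter_tame/clamp_tame.
by do 2 apply: kernel_iter_tame; exact: clamp_tame.
Qed.

Lemma scheme_prefix ds1 ds2 i w : (i <= size ds1)%N ->
  scheme K X Q (ds1 ++ ds2) i w = scheme K X Q ds1 i w.
Proof.
have grid_prefix j : (j <= size ds1)%N -> grid (ds1 ++ ds2) j = grid ds1 j.
  move=> js; apply: eq_bigr => k _.
  by rewrite nth_cat (leq_trans (ltn_ord k) js).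
elim: i => [//|i IH] is1 /=.
by rewrite IH ?(ltnW is1) // /increment !grid_prefix // ltnW.
Qed.

Lemma scheme_itv ds i w : 0 <= Q 0 w <= K -> 0 <= scheme K X Q ds i w <= K.
Proof. by case: i => [//|i] _; exact: clamp_itv. Qed.

Lemma scheme_markov (hX : levy_process X) (hQ : stationary_workload K X Q)
    ds1 ds2 (rho g : R -> R) (B : R) :
  (forall s, s \in ds1 ++ ds2 -> 0 <= s) ->
  measurable_fun setT rho -> (forall x, `|rho x| <= B) -> tame g ->
  \int[P]_w (rho (Q 0 w) * g (scheme K X Q (ds1 ++ ds2) (size (ds1 ++ ds2)) w)) =
  \int[P]_w (rho (Q 0 w) * kernel_iter ds2 g (scheme K X Q ds1 (size ds1) w)).
Proof.
move=> ds0 mrho rhoB tg; elim: ds2 ds1 ds0 => [|s ds2 IH] ds1 ds0.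
  by rewrite cats0.
(* The head s of the future is counted as the last step of the past; [scheme_step] then integrates
   it out, producing one more [kernel_step]. *)
rewrite -cat_rcons IH; last by rewrite cat_rcons.
have nth0 i : 0 <= (rcons ds1 s)`_i.
  have [i1|i1] := ltnP i (size (rcons ds1 s)); last by rewrite nth_default.
  by apply: ds0; rewrite -cat_rcons mem_cat mem_nth.
have tg' := kernel_iter_tame ds2 tg.
have rhoB' x : `|rho x| <= Num.max B K by rewrite le_max rhoB.
have gB' x : `|kernel_iter ds2 g x| <= Num.max B K.
  by rewrite le_max (tame_bounded tg') orbT.
rewrite size_rcons.
apply: etrans (scheme_step hX hQ nth0 (size ds1) mrho (tame_measurable tg') rhoB' gB') _.
apply: eq_Rintegral => w _; rewrite nth_rcons ltnn eqxx -cats1.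
by rewrite scheme_prefix.
Qed.

End kernels.

(** * Rearrangement inequalities *)

Section rearrangement.
Context (R : realType) d (T : measurableType d) (P : probability T R).

Lemma bounded_cvg_Rintegral (f_ : nat -> T -> R) (f : T -> R) (B : R) :
  (forall n, measurable_fun setT (f_ n)) -> measurable_fun setT f ->
  (forall n w, `|f_ n w| <= B) -> (forall w, f_ n w @[n --> \oo] --> f w) ->
  \int[P]_w f_ n w @[n --> \oo] --> \int[P]_w f w.
Proof.
move=> mf_ mf f_B f_f.
have [] := @dominated_convergence _ _ _ P setT measurableT
  (fun n w => (f_ n w)%:E) (fun w => (f w)%:E) (cst B%:E).
- by move=> n; exact/measurable_EFinP.
- exact/measurable_EFinP.
- by apply: aeW => w _; apply: cvg_EFin; [near=> n | exact: f_f].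
- exact: (bounded_rv_integrable P (bounded_rv_cst T B)).
- by apply: aeW => w n _; rewrite /= lee_fin.
move=> intf _ cvg; apply: fine_cvg; rewrite fineK //.
exact: (integrable_fin_num _ intf).
Unshelve. all: by end_near. Qed.

(* [Phi] is convex with subgradient [psi]. *)
Lemma monotone_primitive (psi : R -> R) (C : R) :
  {homo psi : x y / x <= y} -> (forall x, 0 <= psi x <= C) ->
  exists2 Phi : R -> R, {homo Phi : x y / x <= y} &
    forall x y, 0 <= x -> 0 <= y -> (x - y) * psi y <= Phi x - Phi y.
Proof.
move=> psi_le psiC.
(* For x < 0 the interval is empty and Phi x = 0, so Phi is monotone on the whole line because psi
   is nonnegative. *)
pose Phi x := \int[lebesgue_measure]_(z in `[0, x]) psi z.
have mpsi (A : set R) : measurable A -> measurable_fun A psi.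
  by move=> mA; exact: nondecreasing_measurable.
have fin_itv (b1 b2 : bool) (x y : R) :
    (lebesgue_measure ([set` Interval (BSide b1 x) (BSide b2 y)] : set R) < +oo)%E.
  by rewrite lebesgue_measure_itv /=; case: ifP => // _; rewrite -EFinB ltry.
have intpsi (b1 b2 : bool) (x y : R) :
    lebesgue_measure.-integrable [set` Interval (BSide b1 x) (BSide b2 y)] (EFin \o psi).
  apply: measurable_bounded_integrable => //.
    exact: fin_itv.
  - exact: mpsi.
  - exists C; split; first exact: num_real.
    move=> M CM z _ /=; have /andP[p0 pC] := psiC z.
    by rewrite ger0_norm // (le_trans pC) // ltW.
have incr x y : 0 <= x -> x <= y ->
    (y - x) * psi x <= Phi y - Phi x <= (y - x) * psi y.
  move=> x0 xy; rewrite /Phi Rintegral_itvB ?bnd_simp //.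
  have cstE c : \int[lebesgue_measure]_(z in `]x, y]) c = (y - x) * c.
    rewrite Rintegral_cst // [X in fine X]lebesgue_measure_itv /= lte_fin.
    case: ifPn => [_|]; first by rewrite -EFinB /= mulrC.
    rewrite -leNgt => yx; rewrite (_ : y = x) ?subrr ?mulr0 ?mul0r //.
    by apply/eqP; rewrite eq_le yx.
  have intcst c : lebesgue_measure.-integrable `]x, y] (EFin \o (fun=> c)).
    apply: measurable_bounded_integrable => //.
      exact: fin_itv.
    by exists `|c|; split=> [|M cM z _ /=]; [exact: num_real | exact: ltW].
  rewrite -!cstE; apply/andP; split; apply: le_Rintegral => //.
  - by move=> z /=; rewrite in_itv /= => /andP[xz _]; exact/psi_le/ltW.
  - by move=> z /=; rewrite in_itv /= => /andP[_ zy]; exact: psi_le.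
have Phi0 x : x < 0 -> Phi x = 0.
  by move=> x0; rewrite /Phi set_itv_ge ?Rintegral_set0 // bnd_simp -ltNge.
exists Phi => [x y xy|x y x0 y0].
  have [x0|x0] := leP 0 x.
    have /andP[+ _] := incr x y x0 xy; rewrite -[_ <= Phi y]subr_ge0; apply: le_trans.
    by rewrite mulr_ge0 ?subr_ge0 //; case/andP: (psiC x).
  by rewrite Phi0 //; apply: Rintegral_ge0 => z _; case/andP: (psiC z).
have [xy|yx] := leP x y.
  by have /andP[_] := incr x y x0 xy; lra.
by have /andP[] := incr y x y0 (ltW yx).
Qed.

Lemma bounded_rv_itv (K : R) (Z : T -> R) : measurable_fun setT Z ->
  (forall w, 0 <= Z w <= K) -> bounded_rv Z.
Proof.
move=> mZ ZK; split=> //.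
by exists K => w; have /andP[Z0 ?] := ZK w; rewrite ger0_norm.
Qed.

Lemma bounded_rv_comp_homo (K : R) (Z : T -> R) (psi : R -> R) :
  measurable_fun setT Z -> (forall w, 0 <= Z w <= K) -> {homo psi : x y / x <= y} ->
  bounded_rv (fun w => psi (Z w)).
Proof.
move=> mZ ZK psi_le; split.
  by apply: (measurableT_comp _ mZ); exact: nondecreasing_measurable.
exists (`|psi 0| + `|psi K|) => w; have /andP[/psi_le Z0 /psi_le ZK'] := ZK w.
have := ler_norm (psi K); have := ler_norm (- psi 0); rewrite normrN.
have := normr_ge0 (psi 0); have := normr_ge0 (psi K).
by move=> ? ? ? ?; rewrite ler_norml /=; apply/andP; split; lra.
Qed.

(** Subtracting the constant psi m leaves the integral unchanged, as Z - m is centred, and (Z - m)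
    (psi Z - psi m) is nonnegative pointwise. *)
Lemma monotone_covariance_ge0 (K : R) (Z : {RV P >-> R}) (psi : R -> R) :
  (forall w, 0 <= Z w <= K) -> {homo psi : x y / x <= y} ->
  0 <= \int[P]_w ((Z w - \int[P]_w' Z w') * psi (Z w)).
Proof.
move=> ZK psi_le; set m := \int[P]_w' Z w'.
have bZ : bounded_rv Z := bounded_rv_itv (measurable_funPT Z) ZK.
have bpsi := bounded_rv_comp_homo (measurable_funPT Z) ZK psi_le.
have bZm : bounded_rv (fun w => Z w - m) by apply: bounded_rvB => //; exact: bounded_rv_cst.
have <- : \int[P]_w (psi m * (Z w - m)) = 0.
  rewrite bounded_RintegralZl // bounded_RintegralB //; last exact: bounded_rv_cst.
  by rewrite Rintegral_probability_cst subrr mulr0.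
apply: bounded_le_Rintegral.
- by apply: bounded_rvM => //; exact: bounded_rv_cst.
- exact: bounded_rvM.
move=> w; rewrite mulrC -subr_ge0 -mulrBr.
have [/[dup] mZ /psi_le psimZ|/ltW /[dup] Zm /psi_le psiZm] := leP m (Z w).
  by rewrite mulr_ge0 // subr_ge0.
by rewrite mulr_le0 // subr_le0.
Qed.

Lemma monotone_rearrangement (K : R) (Y Z : {RV P >-> R}) (psi : R -> R) (C : R) :
  (forall w, 0 <= Y w <= K) -> (forall w, 0 <= Z w <= K) -> same_law P Y Z ->
  {homo psi : x y / x <= y} -> (forall x, 0 <= psi x <= C) ->
  \int[P]_w (Z w * psi (Y w)) <= \int[P]_w (Z w * psi (Z w)).
Proof.
move=> YK ZK YZ psi_le psiC.
have [Phi Phi_le sub] := monotone_primitive psi_le psiC.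
have bY : bounded_rv Y := bounded_rv_itv (measurable_funPT Y) YK.
have bZ : bounded_rv Z := bounded_rv_itv (measurable_funPT Z) ZK.
have bpsiY := bounded_rv_comp_homo (measurable_funPT Y) YK psi_le.
have bpsiZ := bounded_rv_comp_homo (measurable_funPT Z) ZK psi_le.
have bPhiY := bounded_rv_comp_homo (measurable_funPT Y) YK Phi_le.
have bPhiZ := bounded_rv_comp_homo (measurable_funPT Z) ZK Phi_le.
have K0 : 0 <= K by have /andP[Y0 ?] := YK point; exact: le_trans Y0 _.
have law (f : R -> R) (B : R) : measurable_fun setT f ->
    (forall x, 0 <= x <= K -> `|f x| <= B) ->
    \int[P]_w f (Y w) = \int[P]_w f (Z w).
  (* Precomposing with [clamp] makes f bounded on the whole line without changing it at the values
     of Y and Z. *)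
  move=> mf fB; transitivity (\int[P]_w f (clamp K (Y w))).
    by apply: eq_Rintegral => w _; rewrite clamp_id.
  rewrite (same_law_Rintegral (f := f \o clamp K) (B := B) _ _ YZ) //.
  - by apply: eq_Rintegral => w _; rewrite /= clamp_id.
  - exact: (measurableT_comp mf (measurable_clamp K)).
  - by move=> x; apply: fB; exact: clamp_itv.
have PhiE : \int[P]_w Phi (Y w) = \int[P]_w Phi (Z w).
  apply: (law _ (`|Phi 0| + `|Phi K|)); first exact: nondecreasing_measurable.
  move=> x /andP[/Phi_le x0 /Phi_le xK].
  have := ler_norm (Phi K); have := ler_norm (- Phi 0); rewrite normrN.
  have := normr_ge0 (Phi 0); have := normr_ge0 (Phi K).
  by move=> ? ? ? ?; rewrite ler_norml /=; apply/andP; split; lra.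
have YpsiE : \int[P]_w (Y w * psi (Y w)) = \int[P]_w (Z w * psi (Z w)).
  apply: (law (fun x => x * psi x) (K * C)) => [|x /andP[x0 xK]].
    by apply: measurable_funM => //; exact: nondecreasing_measurable.
  have /andP[p0 pC] := psiC x; rewrite normrM !ger0_norm //.
  exact: ler_pM.
(* Equality of laws turns the claim into E[(Z - Y) psi(Y)] <= 0, the form to which the subgradient
   inequality applies. *)
rewrite -YpsiE -subr_le0 -bounded_RintegralB; [|exact: bounded_rvM..].
have <- : \int[P]_w (Phi (Z w) - Phi (Y w)) = 0.
  by rewrite bounded_RintegralB // PhiE subrr.
apply: bounded_le_Rintegral.
- by apply: bounded_rvB; exact: bounded_rvM.
- exact: bounded_rvB.
move=> w; rewrite -mulrBl; have /andP[? _] := YK w; have /andP[? _] := ZK w.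
exact: sub.
Qed.

End rearrangement.

(** * The autocovariance of the workload *)

Section stationary_covariance.
Context (R : realType) d (T : measurableType d) (P : probability T R).
Variables (K : R) (X Q : R -> {RV P >-> R}).
Hypotheses (K0 : 0 < K) (hX : levy_process X) (hQ : stationary_workload K X Q).

Definition scheme_end (ds : seq R) (w : T) : R := scheme K X Q ds (size ds) w.

(** Grids are concatenations of such lists, so every time at which the scheme is cut is a grid
    point. *)
Definition subdivision (n : nat) (a : R) : seq R := nseq n.+1 (a / n.+1%:R).

Lemma sum_subdivision n a : \sum_(s <- subdivision n a) s = a.
Proof.
by rewrite big_nseq iter_addr_0 -[LHS]mulr_natr divfK // pnatr_eq0.
Qed.

Lemma scheme_end_close (t : R) (w : T) (e : R) : 0 <= t -> 0 < e ->
  exists2 dl, 0 < dl & forall ds, \sum_(s <- ds) s = t ->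
    (forall s, s \in ds -> 0 <= s < dl) -> `|Q t w - scheme_end ds w| <= e.
Proof.
move=> t0 e0; pose Y u := Q 0 w + X u w.
have cY : cadlag Y.
  have [rX lX] := levy_cadlag hX w; split=> u.
    by apply: cvgD; [exact: cvg_cst | exact: rX].
  by apply: is_cvgD; [exact: is_cvg_cst | exact: lX].
have Y0 : 0 <= Y 0 <= K.
  by rewrite /Y (levy_at0 hX) addr0 (workload_initial hQ).
have [dl dl0 close] := reflection_approx (ltW K0) t0 e0 cY Y0.
exists dl => // ds sum_ds mesh; rewrite (workload_reflection hQ) //.
apply: (close (grid ds) (fun i => scheme K X Q ds i w)).
- exact: grid0.
- by rewrite -sum_ds (big_nth 0) big_mkord.
- move=> i; rewrite gridS addrAC subrr add0r.
  have [i1|i1] := ltnP i (size ds); first by apply: mesh; exact: mem_nth.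
  by rewrite nth_default // lexx.
- by rewrite /= /Y (levy_at0 hX) addr0.
- move=> i /=; congr (clamp K (_ + _)); rewrite /increment /Y; ring.
Qed.

Lemma scheme_end_cvg (ds : nat -> seq R) (t a : R) (w : T) : 0 <= t ->
  (forall n, \sum_(s <- ds n) s = t) ->
  (forall n s, s \in ds n -> 0 <= s <= a / n.+1%:R) ->
  scheme_end (ds n) w @[n --> \oo] --> Q t w.
Proof.
move=> t0 sum_ds mesh; apply/cvgrPdist_le => e e0.
have [dl dl0 close] := scheme_end_close w t0 e0.
have a1 : 0 < `|a| + 1 by rewrite ltr_wpDl.
have e1 : 0 < dl / (`|a| + 1) by rewrite divr_gt0.
near=> n; apply: close => // s /mesh /andP[s0 sa]; rewrite s0 /=.
have n1 : n.+1%:R^-1 < dl / (`|a| + 1).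
  by near: n; exact: (near_infty_natSinv_lt (PosNum e1)).
apply: le_lt_trans sa _; move: n1; rewrite ltr_pdivlMr //; apply: le_lt_trans.
by rewrite mulrC ler_wpM2l ?invr_ge0 // (le_trans (ler_norm a)) // lerDl.
Unshelve. all: by end_near. Qed.

Lemma scheme_end_itv ds w : 0 <= scheme_end ds w <= K.
Proof. by apply: scheme_itv; [exact: ltW | exact: (workload_initial hQ)]. Qed.

(** [workload_initial] speaks of time 0 only; at later times the bound is inherited from the clamped
    scheme in the limit, for every outcome and not just almost surely. *)
Lemma workload_itv t w : 0 <= t -> 0 <= Q t w <= K.
Proof.
move=> t0; have cvg : scheme_end (subdivision n t) w @[n --> \oo] --> Q t w.
  apply: (scheme_end_cvg (a := t)) => // [n|n s]; first exact: sum_subdivision.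
  by rewrite mem_nseq => /andP[_ /eqP ->]; rewrite lexx divr_ge0.
apply/andP; split.
  by apply: (cvgr_to_ge cvg); near=> n; case/andP: (scheme_end_itv (subdivision n t) w).
by apply: (cvgr_to_le cvg); near=> n; case/andP: (scheme_end_itv (subdivision n t) w).
Unshelve. all: by end_near. Qed.

Let m := \int[P]_w Q 0 w.

Definition autocov (t : R) : R := \int[P]_w ((Q 0 w - m) * Q t w).

Lemma bounded_rv_workload t : 0 <= t -> bounded_rv (Q t).
Proof.
move=> t0; apply: (bounded_rv_itv (measurable_funPT (Q t))) => w.
exact: workload_itv.
Qed.

Lemma measurable_scheme_end ds : measurable_fun setT (scheme_end ds).
Proof. exact: measurable_scheme. Qed.

Lemma centered_initial_le w : `|Q 0 w - m| <= K.
Proof.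
have /andP[m0 mK] : 0 <= m <= K.
  apply/andP; split.
    by apply: Rintegral_ge0 => w' _; case/andP: (workload_initial hQ w').
  rewrite -[leRHS](Rintegral_probability_cst P); apply: bounded_le_Rintegral.
  - exact: bounded_rv_workload.
  - exact: bounded_rv_cst.
  - by move=> w'; case/andP: (workload_initial hQ w').
have /andP[? ?] := workload_initial hQ w.
by rewrite ler_norml; apply/andP; split; lra.
Qed.

Lemma bounded_rv_centered : bounded_rv (fun w => Q 0 w - m).
Proof. by apply: bounded_rvB; [exact: bounded_rv_workload | exact: bounded_rv_cst]. Qed.

Lemma centered_mean : \int[P]_w (Q 0 w - m) = 0.
Proof.
rewrite bounded_RintegralB; [|exact: bounded_rv_workload|exact: bounded_rv_cst].
by rewrite Rintegral_probability_cst subrr.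
Qed.

Lemma autocov_cvg (ds : nat -> seq R) (t a : R) : 0 <= t ->
  (forall n, \sum_(s <- ds n) s = t) ->
  (forall n s, s \in ds n -> 0 <= s <= a / n.+1%:R) ->
  \int[P]_w ((Q 0 w - m) * scheme_end (ds n) w) @[n --> \oo] --> autocov t.
Proof.
move=> t0 sum_ds mesh; apply: (@bounded_cvg_Rintegral _ _ _ _ _ _ (K * K)).
- move=> n; apply: measurable_funM; first by case: bounded_rv_centered.
  exact: measurable_scheme_end.
- by apply: measurable_funM; [case: bounded_rv_centered | exact: measurable_funPT].
- move=> n w; rewrite normrM ler_pM //; first exact: centered_initial_le.
  by have /andP[f0 fK] := scheme_end_itv (ds n) w; rewrite ger0_norm.
- by move=> w; apply: cvgM; [exact: cvg_cst | exact: scheme_end_cvg mesh].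
Qed.

Lemma autocov_markov ds1 ds2 : (forall s, s \in ds1 ++ ds2 -> 0 <= s) ->
  \int[P]_w ((Q 0 w - m) * scheme_end (ds1 ++ ds2) w) =
  \int[P]_w ((Q 0 w - m) * kernel_iter K X ds2 (clamp K) (scheme_end ds1 w)).
Proof.
move=> ds0; pose rho x := clamp K x - m.
have mrho : measurable_fun setT rho.
  exact: (measurable_funB (tame_measurable (clamp_tame (ltW K0))) (measurable_cst m)).
have rhoB x : `|rho x| <= K + `|m|.
  have /andP[c0 cK] := clamp_itv (ltW K0) x.
  by apply: le_trans (ler_normB _ _) _; rewrite lerD2r ger0_norm.
have := scheme_markov (ltW K0) hX hQ ds0 mrho rhoB (clamp_tame (ltW K0)).
have rhoE w : rho (Q 0 w) = Q 0 w - m by rewrite /rho clamp_id ?(workload_initial hQ).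
under eq_Rintegral do rewrite rhoE.
under [X in _ = X -> _]eq_Rintegral do rewrite rhoE.
move=> <-; apply: eq_Rintegral => w _; congr (_ * _).
by rewrite clamp_id ?scheme_end_itv.
Qed.

(** The centred factor kills additive constants in phi, and the terms coming from m agree because
    Q_h and Q_0 have the same law. What remains is [monotone_rearrangement]. *)
Lemma stationary_rearrangement (phi : R -> R) (h : R) : 0 <= h ->
  (forall x y, 0 <= x -> x <= y -> y <= K -> 0 <= phi y - phi x <= y - x) ->
  \int[P]_w ((Q 0 w - m) * phi (Q h w)) <= \int[P]_w ((Q 0 w - m) * phi (Q 0 w)).
Proof.
(* Normalized to vanish at 0 and extended by clamping, phi becomes monotone on the whole line with
   values in [0, K]. *)
move=> h0 phi_lip; pose psi x := phi (clamp K x) - phi 0.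
have cK x := clamp_itv (ltW K0) x.
have psi_le : {homo psi : x y / x <= y}.
  move=> x y xy; rewrite lerD2r -subr_ge0.
  have /andP[x0 _] := cK x; have /andP[_ yK] := cK y.
  by have /andP[] := phi_lip _ _ x0 (clamp_le K xy) yK.
have psiK x : 0 <= psi x <= K.
  have /andP[x0 xK] := cK x; have /andP[-> /=] := phi_lip _ _ (lexx 0) x0 xK.
  by rewrite subr0 => /le_trans; apply.
have Qh w := workload_itv w h0; have Q0 w := workload_itv w (lexx 0).
have bh := bounded_rv_comp_homo (measurable_funPT (Q h)) Qh psi_le.
have b0 := bounded_rv_comp_homo (measurable_funPT (Q 0)) Q0 psi_le.
have bQ := bounded_rv_workload (lexx 0).
have law := workload_stationary_law hQ h0.
have split_int s : 0 <= s -> \int[P]_w ((Q 0 w - m) * phi (Q s w)) =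
    \int[P]_w (Q 0 w * psi (Q s w)) - m * \int[P]_w psi (Q s w).
  move=> s0.
  have bs : bounded_rv (fun w => psi (Q s w)).
    apply: (bounded_rv_comp_homo (measurable_funPT (Q s)) _ psi_le) => w.
    exact: workload_itv.
  have bQs : bounded_rv (fun w => Q 0 w * psi (Q s w)) := bounded_rvM bQ bs.
  have bms : bounded_rv (fun w => m * psi (Q s w)) := bounded_rvM (bounded_rv_cst T m) bs.
  have bp : bounded_rv (fun w => phi 0 * (Q 0 w - m)).
    exact: (bounded_rvM (bounded_rv_cst T (phi 0)) bounded_rv_centered).
  transitivity (\int[P]_w (Q 0 w * psi (Q s w)) - \int[P]_w (m * psi (Q s w)) +
                \int[P]_w (phi 0 * (Q 0 w - m))); last first.
    rewrite (bounded_RintegralZl P m bs).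
    rewrite (bounded_RintegralZl P (phi 0) bounded_rv_centered).
    by rewrite centered_mean mulr0 addr0.
  rewrite -bounded_RintegralB // -bounded_RintegralD //; last exact: bounded_rvB.
  apply: eq_Rintegral => w _; rewrite /psi (clamp_id (workload_itv w s0)); ring.
rewrite !split_int //.
have -> : \int[P]_w psi (Q h w) = \int[P]_w psi (Q 0 w).
  apply: (same_law_Rintegral (B := K) (measurable_funPT (Q h)) (measurable_funPT (Q 0)) law).
    exact: nondecreasing_measurable.
  by move=> x; have /andP[p0 pK] := psiK x; rewrite ger0_norm.
by rewrite lerD2r; exact: monotone_rearrangement psiK.
Qed.

End stationary_covariance.

(** * Sign, monotonicity and decrements of the autocovariance *)

Section autocovariance_shape.
Context (R : realType) d (T : measurableType d) (P : probability T R).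
Variables (K : R) (X Q : R -> {RV P >-> R}).
Hypotheses (K0 : 0 < K) (hX : levy_process X) (hQ : stationary_workload K X Q).

Let m := \int[P]_w Q 0 w.
Let iter ds := kernel_iter K X ds (clamp K).
Let S ds := scheme_end K X Q ds.

Let iter_tame ds : tame K (iter ds).
Proof. by apply: kernel_iter_tame; [exact: ltW | apply: clamp_tame; exact: ltW]. Qed.

Let iter_lip ds x y : x <= y -> 0 <= iter ds y - iter ds x <= y - x.
Proof. by move=> xy; have [_ /(_ x y xy)] := iter_tame ds. Qed.

Let iter_homo ds : {homo iter ds : x y / x <= y}.
Proof. by move=> x y /(iter_lip ds) /andP[]; rewrite subr_ge0. Qed.

Let bounded_rv_iter ds (Z : T -> R) : measurable_fun setT Z ->
  bounded_rv (fun w => (Q 0 w - m) * iter ds (Z w)).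
Proof.
move=> mZ; apply: bounded_rvM; first exact: (bounded_rv_centered K0 hX hQ).
split; last by exists K => w; exact: (tame_bounded (iter_tame ds)).
exact: (measurableT_comp (tame_measurable (iter_tame ds)) mZ).
Qed.

Let steps_bound (a b : R) n s : 0 <= a -> 0 <= b ->
  s \in subdivision n a ++ subdivision n b -> 0 <= s <= (a + b) / n.+1%:R.
Proof.
move=> a0 b0; rewrite mem_cat !mem_nseq /= => /orP[/eqP ->|/eqP ->];
  by rewrite divr_ge0 //= ler_wpM2r ?invr_ge0 // ?lerDl ?lerDr.
Qed.

Let steps_bound3 (a b c : R) n s : 0 <= a -> 0 <= b -> 0 <= c ->
  s \in subdivision n a ++ (subdivision n b ++ subdivision n c) ->
  0 <= s <= (a + (b + c)) / n.+1%:R.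
Proof.
move=> a0 b0 c0; rewrite mem_cat => /orP[|/(steps_bound b0 c0) /andP[-> /le_trans]].
  rewrite mem_nseq => /andP[_ /eqP ->].
  by rewrite divr_ge0 //= ler_wpM2r ?invr_ge0 // lerDl addr_ge0.
by apply; rewrite ler_wpM2r ?invr_ge0 // lerDr.
Qed.

Let cvg1 (a : R) : 0 <= a ->
  \int[P]_w ((Q 0 w - m) * S (subdivision n a) w) @[n --> \oo] --> autocov Q a.
Proof.
move=> a0; apply: (autocov_cvg K0 hX hQ (a := a)) => // [n|n s].
  exact: sum_subdivision.
by rewrite mem_nseq => /andP[_ /eqP ->]; rewrite lexx divr_ge0.
Qed.

Let cvg2 (a b : R) : 0 <= a -> 0 <= b ->
  \int[P]_w ((Q 0 w - m) * S (subdivision n a ++ subdivision n b) w) @[n --> \oo] -->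
  autocov Q (a + b).
Proof.
move=> a0 b0; apply: (autocov_cvg K0 hX hQ (a := a + b)) => // [|n|n s].
- exact: addr_ge0.
- by rewrite big_cat /= !sum_subdivision.
- exact: steps_bound.
Qed.

Let cvg3 (a b c : R) : 0 <= a -> 0 <= b -> 0 <= c ->
  \int[P]_w ((Q 0 w - m) * S (subdivision n a ++ (subdivision n b ++ subdivision n c)) w)
    @[n --> \oo] --> autocov Q (a + (b + c)).
Proof.
move=> a0 b0 c0; apply: (autocov_cvg K0 hX hQ (a := a + (b + c))) => // [|n|n s].
- by rewrite !addr_ge0.
- by rewrite !big_cat /= !sum_subdivision.
- exact: steps_bound3.
Qed.

(** Cutting at time 0 leaves a function of [Q 0] alone, as the association inequality requires. *)
Let markov0 ds : (forall s, s \in ds -> 0 <= s) ->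
  \int[P]_w ((Q 0 w - m) * S ds w) = \int[P]_w ((Q 0 w - m) * iter ds (Q 0 w)).
Proof. by move=> ds0; exact: (autocov_markov K0 hX hQ (ds1 := [::])). Qed.

Lemma autocov_ge0 t : 0 <= t -> 0 <= autocov Q t.
Proof.
move=> t0; apply: (cvgr_to_ge (cvg1 t0)); near=> n.
rewrite markov0; last by move=> s; rewrite mem_nseq => /andP[_ /eqP ->]; rewrite divr_ge0.
exact: monotone_covariance_ge0 (workload_initial hQ) (iter_homo _).
Unshelve. all: by end_near. Qed.

Lemma autocov_nonincreasing t b : 0 <= t -> 0 <= b -> autocov Q (t + b) <= autocov Q t.
Proof.
move=> t0 b0; apply: (ler_cvg_to (cvg2 t0 b0) (cvg1 t0)); near=> n.
set ut := subdivision n t; set ub := subdivision n b.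
rewrite !markov0; last 2 first.
- by move=> s; rewrite mem_nseq => /andP[_ /eqP ->]; rewrite divr_ge0.
- by move=> s /(steps_bound t0 b0) /andP[].
have bQ : measurable_fun setT (Q 0) := measurable_funPT (Q 0).
rewrite -subr_ge0 -bounded_RintegralB; [|exact: bounded_rv_iter..].
pose psi x := iter ut (clamp K x) - iter (ut ++ ub) (clamp K x).
have psi_le : {homo psi : x y / x <= y}.
  move=> x y xy; have /andP[cx _] := clamp_itv (ltW K0) x.
  have /andP[_ cy] := clamp_itv (ltW K0) y.
  by apply: kernel_iter_diff => //; [exact: ltW | exact: clamp_le].
have := monotone_covariance_ge0 (workload_initial hQ) psi_le.
congr (0 <= _); apply: eq_Rintegral => w _.
by rewrite /psi (clamp_id (workload_initial hQ w)) -mulrBr.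
Unshelve. all: by end_near. Qed.

Lemma autocov_decrement h t b : 0 <= h -> 0 <= t -> 0 <= b ->
  autocov Q (h + t) - autocov Q (h + (t + b)) <= autocov Q t - autocov Q (t + b).
Proof.
move=> h0 t0 b0.
(* The factor K is the bound on |Q_0 - m|. *)
pose err n := K * \int[P]_w `|S (subdivision n h) w - Q h w|.
have mS ds : measurable_fun setT (S ds) by exact: measurable_scheme_end.
have Kge0 := ltW K0.
have err_le n w : `|S (subdivision n h) w - Q h w| <= K.
  have /andP[? ?] := scheme_end_itv K0 hQ (subdivision n h) w.
  have /andP[? ?] := workload_itv K0 hX hQ w h0.
  by rewrite /S ler_norml; apply/andP; split; lra.
have brv_err n : bounded_rv (fun w => `|S (subdivision n h) w - Q h w|).
  split; last by exists K => w; rewrite normr_id.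
  by apply: measurableT_comp => //; apply: measurable_funB => //; exact: measurable_funPT.
have err0 : err n @[n --> \oo] --> 0.
  rewrite -[X in _ --> X](mulr0 K); apply: cvgM; first exact: cvg_cst.
  have -> : 0 = \int[P]_w (cst 0 w) :> R by rewrite Rintegral_probability_cst.
  apply: (bounded_cvg_Rintegral (B := K)) => [n||n w|w].
  - by case: (brv_err n).
  - exact: measurable_cst.
  - by rewrite normr_id.
  - rewrite -[X in _ --> X](@normr0 R R); apply: cvg_norm; apply/subr_cvg0.
    apply: (scheme_end_cvg K0 hX hQ (a := h)) => // [n|n s]; first exact: sum_subdivision.
    by rewrite mem_nseq => /andP[_ /eqP ->]; rewrite lexx divr_ge0.
pose I ds := \int[P]_w ((Q 0 w - m) * S ds w).
(* Both grids start with the same subdivision of [0, h]; cutting at h leaves the difference of two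
   iterated kernels at one value, the phi below. *)
pose lhs n := I (subdivision n h ++ subdivision n t) -
  I (subdivision n h ++ (subdivision n t ++ subdivision n b)).
pose rhs n := I (subdivision n t) - I (subdivision n t ++ subdivision n b) + err n.
have lhs_cvg : lhs n @[n --> \oo] --> autocov Q (h + t) - autocov Q (h + (t + b)).
  exact: cvgB (cvg2 h0 t0) (cvg3 h0 t0 b0).
have rhs_cvg : rhs n @[n --> \oo] --> autocov Q t - autocov Q (t + b).
  rewrite -[X in _ --> X]addr0.
  exact: cvgD (cvgB (cvg1 t0) (cvg2 t0 b0)) err0.
apply: (ler_cvg_to lhs_cvg rhs_cvg).
near=> n; rewrite /lhs /rhs /I /err.
set uh := subdivision n h; set ut := subdivision n t; set ub := subdivision n b.
have ut0 s : s \in ut -> 0 <= s.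
  by rewrite mem_nseq => /andP[_ /eqP ->]; rewrite divr_ge0.
have utb0 s : s \in ut ++ ub -> 0 <= s by move=> /(steps_bound t0 b0) /andP[].
have uht0 s : s \in uh ++ ut -> 0 <= s by move=> /(steps_bound h0 t0) /andP[].
have uhtb0 s : s \in uh ++ (ut ++ ub) -> 0 <= s.
  by move=> /(steps_bound3 h0 t0 b0) /andP[].
rewrite (markov0 ut0) (markov0 utb0).
rewrite (autocov_markov K0 hX hQ uht0) (autocov_markov K0 hX hQ uhtb0).
pose phi x := iter ut x - iter (ut ++ ub) x.
(* The lower bound is [kernel_iter_diff]; the upper one combines the Lipschitz bound of the first
   term with the monotonicity of the second. *)
have phi_lip x y : 0 <= x -> x <= y -> y <= K -> 0 <= phi y - phi x <= y - x.
  move=> x0 xy yK; have := kernel_iter_diff X Kge0 ut ub x0 xy yK.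
  rewrite -/(iter _) -/(iter _) -/(phi x) -/(phi y) => phixy.
  have /andP[_] := iter_lip ut xy; have /andP[+ _] := iter_lip (ut ++ ub) xy.
  by move: phixy; rewrite /phi => ? ? ?; apply/andP; split; lra.
have phi_dist x y : 0 <= x <= K -> 0 <= y <= K -> `|phi x - phi y| <= `|x - y|.
  move=> /andP[x0 xK] /andP[y0 yK]; have [xy|/ltW yx] := leP x y.
    have /andP[? ?] := phi_lip _ _ x0 xy yK.
    by rewrite distrC [leRHS]distrC !ger0_norm // subr_ge0.
  have /andP[? ?] := phi_lip _ _ y0 yx xK.
  by rewrite !ger0_norm // subr_ge0.
have brv_phi (Z : T -> R) : measurable_fun setT Z ->
    bounded_rv (fun w => (Q 0 w - m) * phi (Z w)).
  move=> mZ; rewrite (_ : (fun w => _) = (fun w => (Q 0 w - m) * iter ut (Z w) -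
    (Q 0 w - m) * iter (ut ++ ub) (Z w))); last by apply/funext => w; rewrite mulrBr.
  by apply: bounded_rvB; exact: bounded_rv_iter.
have phiE (Z : T -> R) : measurable_fun setT Z ->
    \int[P]_w ((Q 0 w - m) * iter ut (Z w)) -
    \int[P]_w ((Q 0 w - m) * iter (ut ++ ub) (Z w)) =
    \int[P]_w ((Q 0 w - m) * phi (Z w)).
  move=> mZ; rewrite -bounded_RintegralB; try exact: bounded_rv_iter.
  by apply: eq_Rintegral => w _; rewrite mulrBr.
rewrite (phiE _ (mS uh)) (phiE _ (measurable_funPT (Q 0))).
apply: le_trans (lerD (stationary_rearrangement K0 hX hQ h0 phi_lip) (lexx _)).
rewrite -(bounded_RintegralZl P K (brv_err n)).
have brv_Kerr := bounded_rvM (bounded_rv_cst T K) (brv_err n).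
rewrite -(bounded_RintegralD P (brv_phi _ (measurable_funPT (Q h))) brv_Kerr).
apply: bounded_le_Rintegral.
- exact: brv_phi.
- by apply: bounded_rvD => //; exact: (brv_phi _ (measurable_funPT (Q h))).
move=> w; rewrite -lerBlDl -mulrBr; apply: le_trans (ler_norm _) _.
rewrite normrM ler_pM //; first exact: (centered_initial_le K0 hX hQ).
by apply: phi_dist; [exact: (scheme_end_itv K0 hQ) | exact: (workload_itv K0 hX hQ)].
Unshelve. all: by end_near. Qed.

End autocovariance_shape.

(** * Convexity and the correlation function *)

Section convexity.
Variables (R : realType) (c : R -> R).
Hypothesis c_le : forall t b, 0 <= t -> 0 <= b -> c (t + b) <= c t.
Hypothesis c_decr : forall t e, 0 <= t -> 0 <= e ->
  c (t + e) - c (t + e + e) <= c t - c (t + e).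

(* Comparing decrements over the grid of mesh [e = a / n]: those before [x + a]
   are at least, and those after it at most, the one just before [x + a]. *)
Lemma decrement_slopes x a b : 0 <= x -> 0 < a -> 0 < b ->
  a * (c (x + a) - c (x + a + b)) <= b * (c x - c (x + a)).
Proof.
move=> x0 a0 b0.
set V := c x - c (x + a); set U := c (x + a) - c (x + a + b).
have V0 : 0 <= V by rewrite subr_ge0 c_le // ltW.
(* The error term is the cost of rounding b up to a multiple of the mesh a / n.+1, and it vanishes
   as n grows. *)
suff H n : a * U <= b * V + a * V / n.+1%:R.
  apply/ler_addgt0Pr => e e0.
  have av0 : 0 <= a * V by rewrite mulr_ge0 // ltW.
  pose n := Num.truncn (a * V / e).
  apply: le_trans (H n) _; rewrite lerD2l ler_pdivrMr // -ler_pdivrMl //.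
  by rewrite mulrC ltW // truncnS_gt.
pose e := a / n.+1%:R.
have e0 : 0 < e by rewrite divr_gt0.
pose g i := c (x + e *+ i) - c (x + e *+ i.+1).
have xe0 i : 0 <= x + e *+ i by rewrite addr_ge0 // mulrn_wge0 // ltW.
have g_le i j : (i <= j)%N -> g j <= g i.
  move: i j; apply: (homo_leq (r := fun u v => v <= u)) => [//|u v w /[swap]|i].
    exact: le_trans.
  have := c_decr (xe0 i) (ltW e0).
  by rewrite /g !mulrSr !addrA.
have g_ge0 i : 0 <= g i.
  by rewrite subr_ge0 mulrSr addrA c_le // ltW.
have sum_g i j : (i <= j)%N -> \sum_(i <= k < j) g k = c (x + e *+ i) - c (x + e *+ j).
  move=> ij; have := telescope_sumr (fun k => - c (x + e *+ k)) ij.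
  rewrite opprK addrC => <-.
  by apply: eq_bigr => k _; rewrite opprK addrC.
have xaE : x + a = x + e *+ n.+1 by rewrite -[e *+ _]mulr_natr divfK // pnatr_eq0.
have Vg : g n * n.+1%:R <= V.
  rewrite /V xaE -[x in c x - _]addr0 -[0](mulr0n e) -sum_g // mulr_natr.
  rewrite -[X in _ *+ X]subn0 -sumr_const_nat; apply: ler_sum_nat => i /andP[_ ik].
  exact: g_le.
(* Rounding up reaches a grid point at or beyond x + a + b; as c is nonincreasing, U is at most the
   sum of the k decrements after x + a. *)
pose k := (Num.truncn (b / e)).+1.
have bk : b <= e * k%:R.
  by rewrite -ler_pdivrMl // mulrC ltW // truncnS_gt.
have ke : k%:R <= b / e + 1.
  by rewrite /k -natr1 lerD2r truncn_le // divr_ge0 // ltW.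
have Ug : U <= g n * k%:R.
  have -> : U = (c (x + a) - c (x + e *+ (n.+1 + k))) -
      (c (x + a + b) - c (x + e *+ (n.+1 + k))) by rewrite /U; ring.
  rewrite lerBlDr; apply: (@le_trans _ _ (g n * k%:R)); last first.
    rewrite lerDl subr_ge0 mulrnDr addrA -xaE.
    have -> : e *+ k = b + (e * k%:R - b) by rewrite mulr_natr; ring.
    by rewrite [X in c X <= _]addrA c_le ?subr_ge0 // !addr_ge0 // ltW.
  rewrite xaE -sum_g ?leq_addr // mulr_natr.
  rewrite -[X in _ <= _ *+ X](addKn n.+1 k) -sumr_const_nat.
  by apply: ler_sum_nat => i /andP[ni _]; exact/g_le/ltnW.
have n0 : 0 < n.+1%:R :> R by [].
have eE : e * n.+1%:R = a by rewrite divfK // pnatr_eq0.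
apply: (@le_trans _ _ (a * (g n * (b / e + 1)))).
  by apply: ler_wpM2l; [exact: ltW | apply: le_trans Ug _; exact: ler_wpM2l].
have -> : a * (g n * (b / e + 1)) = b * (g n * n.+1%:R) + a * (g n * n.+1%:R) / n.+1%:R.
  have alg (r s z : R) : s != 0 -> z != 0 ->
      z * s * (r * (b / z + 1)) = b * (r * s) + z * s * (r * s) / s.
    by move=> ? ?; field; apply/andP.
  by rewrite -{1 2}eE alg // gt_eqF.
apply: lerD; first by rewrite ler_pM2l.
by rewrite ler_pM2r ?invr_gt0 // ler_pM2l.
Qed.

Lemma decrement_chord x y l : 0 <= x -> x < y -> 0 < l -> l < 1 ->
  c (l * x + (1 - l) * y) <= l * c x + (1 - l) * c y.
Proof.
move=> x0 xy l0 l1; have yx : 0 < y - x by rewrite subr_gt0.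
(* With these two lengths x + a is the point l x + (1 - l) y and x + a + b = y; divided by y - x,
   the slope inequality is the chord inequality. *)
have a0 : 0 < (1 - l) * (y - x) by rewrite mulr_gt0 // subr_gt0.
have b0 : 0 < l * (y - x) by rewrite mulr_gt0.
have := decrement_slopes x0 a0 b0.
have -> : x + (1 - l) * (y - x) + l * (y - x) = y by ring.
have -> : x + (1 - l) * (y - x) = l * x + (1 - l) * y by ring.
set z := l * x + _ => h.
rewrite -(ler_pM2l yx) -subr_ge0; rewrite -subr_ge0 in h.
by apply: le_trans h _; rewrite le_eqVlt; apply/orP; left; apply/eqP; ring.
Qed.

Lemma convex_of_decrements : convex_function (`[0, +oo[%classic : set R) c.
Proof.
move=> t x y; rewrite !inE /= !in_itv /= !andbT => x0 y0.
rewrite convRE (convRE (x : R^o) (y : R^o) t : conv t x y = _) /unstable.onem.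
have : 0 <= t%:num by []; have : t%:num <= 1 by [].
move: (t%:num) => l; rewrite le_eqVlt => /predU1P[-> _|l1].
  by rewrite subrr !mul1r !mul0r !addr0.
rewrite le_eqVlt => /predU1P[<-|l0]; first by rewrite subr0 !mul1r !mul0r !add0r.
have [xy|yx|->] := ltgtP x y.
- exact: decrement_chord.
- have := @decrement_chord y x (1 - l) y0 yx.
  by rewrite subr_gt0 gtrBl subKr addrC [in X in _ <= X]addrC; apply.
- by rewrite -!mulrDl addrC subrK !mul1r.
Qed.

End convexity.

Section correlation.
Context (R : realType) d (T : measurableType d) (P : probability T R).
Variables (K : R) (X Q : R -> {RV P >-> R}).
Hypotheses (K0 : 0 < K) (hX : levy_process X) (hQ : stationary_workload K X Q).

(** Centring one factor suffices: centring Q_t as well only subtracts mt E[Q_0 - m] = 0. *)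
Lemma covariance_autocov (t : R) : 0 <= t ->
  fine (covariance P (Q 0) (Q t)) = autocov Q t.
Proof.
move=> t0; rewrite covariance.unlock !expectation.unlock.
set m := fine (\int[P]_w (Q 0 w)%:E)%E; set mt := fine (\int[P]_w (Q t w)%:E)%E.
have bc : bounded_rv (fun w => Q 0 w - m) := bounded_rv_centered K0 hX hQ.
have bt : bounded_rv (Q t) := bounded_rv_workload K0 hX hQ t0.
transitivity (\int[P]_w ((Q 0 w - m) * Q t w - mt * (Q 0 w - m))).
  rewrite /Rintegral; congr fine; apply: eq_integral => w _ /=; congr (_%:E).
  by rewrite mulrBr [mt * _]mulrC.
rewrite bounded_RintegralB; [|exact: bounded_rvM|]; last first.
  exact: (bounded_rvM (bounded_rv_cst T mt) bc).
rewrite (bounded_RintegralZl P mt bc).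
by rewrite (centered_mean K0 hX hQ : \int[P]_w (Q 0 w - m) = 0) mulr0 subr0.
Qed.

Lemma stationary_variance (t : R) : 0 <= t ->
  fine ('V_P[Q t])%E = fine ('V_P[Q 0%R])%E.
Proof.
move=> t0; have Kge0 := ltW K0.
have stationary (f : R -> R) (B : R) : measurable_fun setT f ->
    (forall x, 0 <= x <= K -> `|f x| <= B) ->
    \int[P]_w f (Q t w) = \int[P]_w f (Q 0 w).
  move=> mf fB.
  have clampE s : 0 <= s -> \int[P]_w f (Q s w) = \int[P]_w (f \o clamp K) (Q s w).
    move=> s0; apply: eq_Rintegral => w _.
    by rewrite /= clamp_id // (workload_itv K0 hX hQ).
  rewrite !clampE //; apply: (same_law_Rintegral (B := B) (measurable_funPT (Q t))
    (measurable_funPT (Q 0)) (workload_stationary_law hQ t0)).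
    exact: (measurableT_comp mf (measurable_clamp K)).
  by move=> x; apply: fB; exact: clamp_itv.
have meanE : \int[P]_w Q t w = \int[P]_w Q 0 w.
  by apply: (stationary id K) => // x /andP[x0 xK]; rewrite ger0_norm.
have varE s : fine ('V_P[Q s])%E =
    \int[P]_w ((Q s w - \int[P]_w' Q s w') * (Q s w - \int[P]_w' Q s w')).
  by rewrite /variance covariance.unlock !expectation.unlock.
rewrite !varE meanE; set m := \int[P]_w Q 0 w.
have mB : measurable_fun setT (fun x : R => x - m).
  by apply: measurable_funB; [exact: measurable_id | exact: measurable_cst].
apply: (stationary (fun x => (x - m) * (x - m)) ((K + `|m|) * (K + `|m|))).
  exact: measurable_funM.
move=> x /andP[x0 xK]; have xm : `|x - m| <= K + `|m|.
  by apply: le_trans (ler_normB _ _) _; rewrite lerD2r ger0_norm.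
by rewrite normrM ler_pM.
Qed.

(** By stationarity both variances are that of [Q 0], so the normalizing factor is constant in t and
    the shape of [autocov] carries over. *)
Lemma correlation_autocov : exists2 k, 0 <= k &
  forall t, 0 <= t -> correlation_function Q t = k * autocov Q t.
Proof.
exists (Num.sqrt (fine ('V_P[Q 0%R])%E * fine ('V_P[Q 0%R])%E))^-1.
  by rewrite invr_ge0 sqrtr_ge0.
move=> t t0; rewrite /correlation_function covariance_autocov //.
by rewrite stationary_variance // mulrC.
Qed.

End correlation.

Theorem theorem2 (R : realType) (d : measure_display) (T : measurableType d)
    (P : probability T R) (K : R) (X Q : R -> {RV P >-> R})
    (hK : 0 < K)
    (hX : levy_process X)
    (hQ : stationary_workload K X Q)
    (hVar : (0 < 'V_P[Q 0%R])%E) :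
  [/\ forall t : R, 0 <= t -> 0 <= correlation_function Q t,
      forall s t : R, 0 <= s -> s <= t ->
        correlation_function Q t <= correlation_function Q s &
      convex_function (`[0, +oo[%classic : set R) (correlation_function Q)].
Proof.
have [k k0 corE] := correlation_autocov hK hX hQ.
have corr_le t b : 0 <= t -> 0 <= b ->
    correlation_function Q (t + b) <= correlation_function Q t.
  move=> t0 b0; rewrite !corE ?addr_ge0 //; apply: ler_wpM2l => //.
  exact: (autocov_nonincreasing hK hX hQ).
split=> [t t0|s t s0 st|].
- by rewrite corE // mulr_ge0 // (autocov_ge0 hK hX hQ).
- by rewrite -[t](subrKC s) corr_le // subr_ge0.
- apply: convex_of_decrements => // t e t0 e0.
  rewrite !corE ?addr_ge0 // -!mulrBr; apply: ler_wpM2l => //.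
  (* Taking the time shift equal to the step e compares consecutive decrements of equal length. *)
  have := autocov_decrement hK hX hQ e0 t0 e0.
  by rewrite [e + (t + e)]addrC [e + t]addrC.
Qed.
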